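(* For real $n\times n$ matrices $A=(a_{ij})$ and $B=(b_{ij})$, $n\ge 4$, where $A$ has constant row and column sums and a constant diagonal, let $f:S_n\to\mathbb{R}$ be $f(\sigma)=\sum_{i,j=1}^n b_{\sigma(i)\sigma(j)}a_{ij}$, let $f_0=f-\frac1{n!}\sum_{\sigma\in S_n}f(\sigma)$, and let $\tau$ be an optimal permutation, so that $f_0(\tau)=\max_{\sigma\in S_n}f_0(\sigma)$. (1) Let us fix any $\alpha>1$. Then there exists a $\delta=\delta(\alpha)>0$ such that for all sufficiently large $n\ge N(\alpha)$ the probability that a random permutation $\sigma$ in $S_n$ satisfies the inequality $$f_0(\sigma)\ge\frac{\alpha}{n^2}f_0(\tau)$$ is at least $\delta n^{-2}$. In particular, one can choose $\delta=\exp\{-c\sqrt{\alpha}\ln\alpha\}$ for some absolute constant $c>0$. (2) Let us fix any $\epsilon>0$. Then there exists a $\delta=\delta(\epsilon)<1$ such that for all sufficiently large $n\ge N(\epsilon)$ the probability that a random permutation $\sigma$ in $S_n$ satisfies the inequality $$f_0(\sigma)\ge n^{-\epsilon}f_0(\tau)$$ is at least $\exp\{-n^{\delta}\}$. In particular, one can choose any $\delta>1-\epsilon/2$.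
   Context: $S_n$ is the group of permutations of $\{1,\dots,n\}$; a random permutation is chosen uniformly from $S_n$. ''Constant row and column sums'' means there is a number $a$ with $\sum_{i}a_{ij}=a$ for all $j$ and $\sum_j a_{ij}=a$ for all $i$; ''constant diagonal'' means there is a number $b$ with $a_{ii}=b$ for all $i$.
   Formalization: In the last claim of (2), ''any δ>1−ε/2'' is taken with δ>0, since for ε>2 and δ≤0 the claim is false (e.g. B=E12−E21 and A its antisymmetric zero-sum projection give f_0>0 with probability only about 2/n). *)

(* Defs.v *)
From mathcomp Require Import all_boot all_order all_algebra all_fingroup.
From mathcomp Require Import all_classical all_reals all_analysis.

Set Implicit Arguments.
Unset Strict Implicit.
Unset Printing Implicit Defensive.

Import Order.TTheory GRing.Theory Num.Theory.
Local Open Scope ring_scope.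

Definition const_line_sums (R : realType) (n : nat) (A : 'M[R]_n) : Prop :=
  exists a : R, (forall j, \sum_i A i j = a) /\ (forall i, \sum_j A i j = a).

Definition const_diagonal (R : realType) (n : nat) (A : 'M[R]_n) : Prop :=
  exists b : R, forall i, A i i = b.

Definition qap (R : realType) (n : nat) (A B : 'M[R]_n) (s : 'S_n) : R :=
  \sum_i \sum_j B (s i) (s j) * A i j.

Definition qap_mean (R : realType) (n : nat) (A B : 'M[R]_n) : R :=
  (n`!%:R)^-1 * \sum_(s : 'S_n) qap A B s.

Definition qap0 (R : realType) (n : nat) (A B : 'M[R]_n) (s : 'S_n) : R :=
  qap A B s - qap_mean A B.

Definition qap_optimal (R : realType) (n : nat) (A B : 'M[R]_n) (t : 'S_n) :
    Prop :=
  forall s : 'S_n, qap0 A B s <= qap0 A B t.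

Definition perm_prob (R : realType) (n : nat) (E : pred 'S_n) : R :=
  #|[set s : 'S_n | E s]|%:R / n`!%:R.

(* The threshold N depends only on the two functions r and p (hence on alpha,
   delta or epsilon, delta), uniformly in the matrices A, B and in t. *)
Definition eventually_prob_ge (R : realType) (r p : nat -> R) : Prop :=
  exists N : nat, forall (n : nat) (A B : 'M[R]_n) (t : 'S_n),
    (4 <= n)%N -> (N <= n)%N ->
    const_line_sums A -> const_diagonal A -> qap_optimal A B t ->
    perm_prob R (fun s => r n * qap0 A B t <= qap0 A B s) >= p n.

(* Main.v *)
(* After normalization, [f_0] becomes [F s = \sum A i j * B (s i) (s j)], where
   [A] and [B] have zero line sums and zero diagonals, and [F 1 = 1 = max F].

   (1) If the threshold alpha/n^2 is passed with probability below n^-2, then the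
   mean of |F| is O(n^-2), since F has mean zero and F <= 1.  Testing F against
   signs of entries of B and against Riesz products of such signs, antisymmetrized
   by disjoint transpositions (F has degree two, so triple products do not
   contribute), shows that the symmetric and the antisymmetric parts of F are each
   either uniformly small or of bounded l^1 mass.  Hence F(1) = 1 forces a pair
   {i, j} with a contribution bounded below, and on the permutations fixing i and
   j, a proportion 1/(n(n-1)), F stays close to that contribution.  So the
   probability is at least (1 - o(1)) n^-2 for every alpha, and any
   delta(alpha) < 1 is admissible.

   (2) The mean of F over the conjugacy class of a permutation with f fixed points
   is at least f(f-3)/n^2, where the number of 2-cycles is chosen according to the
   sign of [\sum A i j * B j i].  With the remaining points in one or two cycles,
   the class has at least n! / n^(f+3) elements; take f of order n^(1-eps/2). *)

Require Import Defs.
From mathcomp Require Import all_boot all_order all_algebra all_fingroup.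
From mathcomp Require Import ring lra zify.
From mathcomp Require Import all_classical all_reals all_analysis.

Set Implicit Arguments.
Unset Strict Implicit.
Unset Printing Implicit Defensive.

Import Order.TTheory GRing.Theory Num.Theory.
Local Open Scope ring_scope.

(** * Zero-sum matrices *)

Definition zero_sum (R : realFieldType) (n : nat) (A : 'M[R]_n) : Prop :=
  [/\ forall i, \sum_j A i j = 0, forall j, \sum_i A i j = 0
    & forall i, A i i = 0].

Definition bil (R : realFieldType) (n : nat) (A B : 'M[R]_n) (s : 'S_n) : R :=
  \sum_i \sum_j A i j * B (s i) (s j).

Lemma zero_sum_tr (R : realFieldType) (n : nat) (A : 'M[R]_n) :
  zero_sum A -> zero_sum A^T.
Proof.
case=> Ar Ac Ad; split=> [i|j|i]; last by rewrite mxE.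
  by rewrite -[RHS](Ac i); apply: eq_bigr => j _; rewrite mxE.
by rewrite -[RHS](Ar j); apply: eq_bigr => i _; rewrite mxE.
Qed.

Lemma perm_pair_trans (n : nat) (i j k l : 'I_n) : i != j -> k != l ->
  exists p : 'S_n, p i = k /\ p j = l.
Proof.
move=> ij kl; exists (tperm i k * tperm (tperm i k j) l)%g.
rewrite !permM tpermL tpermL; split=> //; apply: tpermD; last by rewrite eq_sym.
by apply: contraNneq ij => h; rewrite -(inj_eq (@perm_inj _ (tperm i k))) tpermL h.
Qed.

(** Two-transitivity makes the sum the same for every ordered pair of distinct points; summing over
    all [n * n.-1] pairs and exchanging the sums evaluates it. *)
Lemma sum_perm_pair (R : realFieldType) (n : nat) (phi : 'I_n -> 'I_n -> R)
    (i j : 'I_n) : i != j ->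
  \sum_(s : 'S_n) phi (s i) (s j) =
  (n.-2)`!%:R * \sum_k \sum_(l | l != k) phi k l.
Proof.
move=> ij; set X := LHS.
have inv k l : l != k -> \sum_(s : 'S_n) phi (s k) (s l) = X.
  rewrite eq_sym => kl; have [p [pi pj]] := perm_pair_trans ij kl.
  rewrite /X [RHS](reindex_inj (mulgI p)); apply: eq_bigr => s _.
  by rewrite !permM pi pj.
have E1 : \sum_k \sum_(l | l != k) \sum_(s : 'S_n) phi (s k) (s l) =
    (n * n.-1)%:R * X.
  transitivity (\sum_(k : 'I_n) (n.-1)%:R * X).
    apply: eq_bigr => k _; rewrite (eq_bigr (fun=> X)); last exact: inv.
    rewrite sumr_const (_ : #|_| = n.-1) ?mulr_natl //.
    by rewrite (eq_card (B := predC1 k)) ?cardC1 ?card_ord.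
  by rewrite sumr_const card_ord -[LHS]mulr_natl mulrA natrM.
have E2 : \sum_k \sum_(l | l != k) \sum_(s : 'S_n) phi (s k) (s l) =
    n`!%:R * \sum_k \sum_(l | l != k) phi k l.
  under eq_bigr do rewrite exchange_big.
  rewrite exchange_big /= (eq_bigr (fun=> \sum_k \sum_(l | l != k) phi k l)).
    by rewrite sumr_const card_Sn mulr_natl.
  move=> s _; rewrite [RHS](reindex_inj (@perm_inj _ s)).
  apply: eq_bigr => k _; rewrite [RHS](reindex_inj (@perm_inj _ s)) /=.
  by apply: eq_bigl => l; rewrite (inj_eq perm_inj).
have n2 : (1 < n)%N.
  case: n i j ij {phi X inv E1 E2} => [[]//|[|n]//] i j.
  by rewrite !ord1 eqxx.
case: n n2 i j phi X ij inv E1 E2 => [|[|n]] // _ i j phi X _ _ E1 E2.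
have nz : (n.+2 * n.+1)%:R != 0 :> R by rewrite pnatr_eq0.
apply: (mulfI nz); rewrite -E1 E2 mulrA; congr (_ * _).
by rewrite -natrM !factS mulnA.
Qed.

Lemma sum_off2 (R : realFieldType) (n : nat) (f : 'I_n -> R) (k l : 'I_n)
    (c : R) : k != l -> (forall q, q != k -> q != l -> f q = c) ->
  \sum_q f q = f k + f l + (n%:R - 2) * c.
Proof.
move=> kl fc.
have -> : \sum_q f q = \sum_q (f q - c) + n%:R * c.
  by rewrite sumrB sumr_const card_ord mulr_natl subrK.
rewrite (bigD1 k) //= (bigD1 l) 1?eq_sym //= big1 => [|q /andP[qk ql]].
  by ring.
by rewrite fc // subrr.
Qed.

Lemma sum_off3 (R : realFieldType) (n : nat) (f : 'I_n -> R) (j k l : 'I_n)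
    (c : R) : j != k -> j != l -> k != l ->
  (forall q, q != j -> q != k -> q != l -> f q = c) ->
  \sum_q f q = f j + f k + f l + (n%:R - 3) * c.
Proof.
move=> jk jl kl fc.
have -> : \sum_q f q = \sum_q (f q - c) + n%:R * c.
  by rewrite sumrB sumr_const card_ord mulr_natl subrK.
rewrite (bigD1 j) //= (bigD1 k) 1?eq_sym //= (bigD1 l) /=.
  rewrite big1 => [|q /andP[/andP[qj qk] ql]]; first by ring.
  by rewrite fc // subrr.
by rewrite ![l == _]eq_sym jl kl.
Qed.

Arguments sum_off2 {R n f} k l c.
Arguments sum_off3 {R n f} j k l c.

(** Satisfied by sums over [S_n] in which the images of [k] and [l] are singled out. Together with
    zero line sums it leaves only the entries [V k l] and [V l k] free. *)
Definition stab_inv (R : realFieldType) (n : nat) (V : 'M[R]_n) (k l : 'I_n) :=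
  forall p : 'S_n, p k = k -> p l = l -> forall i j, V (p i) (p j) = V i j.

(** Transposing two other points shows that row [k] is constant off [k] and [l]; the zero row sum
    then gives the constant. *)
Lemma stab_inv_row (R : realFieldType) (n : nat) (V : 'M[R]_n) (k l q : 'I_n) :
  k != l -> zero_sum V -> stab_inv V k l -> q != k -> q != l ->
  (n%:R - 2) * V k q = - V k l.
Proof.
move=> kl [Vr _ Vd] Vi qk ql.
have /eqP := Vr k; rewrite (sum_off2 k l (V k q)) // => [|r rk rl].
  by rewrite Vd add0r addrC addr_eq0 => /eqP.
by rewrite -(Vi (tperm r q)) ?tpermL ?tpermD.
Qed.

Lemma stab_inv_out (R : realFieldType) (n : nat) (V : 'M[R]_n)
    (k l p q : 'I_n) :
  k != l -> zero_sum V -> stab_inv V k l ->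
  p != k -> p != l -> q != k -> q != l -> p != q ->
  (n%:R - 3) * V p q = - (V p k + V p l).
Proof.
move=> kl [Vr _ Vd] Vi pk pl qk ql pq.
have /eqP := Vr p; rewrite (sum_off3 p k l (V p q)) // => [|r rp rk rl].
  by rewrite Vd add0r addrC addr_eq0 => /eqP.
by rewrite -(Vi (tperm r q)) ?tpermL ?tpermD // eq_sym.
Qed.

Lemma stab_inv_tr (R : realFieldType) (n : nat) (V : 'M[R]_n) (k l : 'I_n) :
  stab_inv V k l -> stab_inv V^T k l.
Proof. by move=> Vi p pk pl i j; rewrite !mxE Vi. Qed.

Lemma stab_inv_sym (R : realFieldType) (n : nat) (V : 'M[R]_n) (k l : 'I_n) :
  stab_inv V k l -> stab_inv V l k.
Proof. by move=> Vi p pk pl i j; rewrite Vi. Qed.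

Lemma stab_inv_entries (R : realFieldType) (n : nat) (V : 'M[R]_n)
    (k l : 'I_n) : (4 <= n)%N -> k != l -> zero_sum V ->
  stab_inv V k l ->
  forall q, q != k -> q != l ->
  [/\ V k q = - V k l / (n%:R - 2), V q l = - V k l / (n%:R - 2),
      V l q = - V l k / (n%:R - 2), V q k = - V l k / (n%:R - 2)
    & forall p, p != k -> p != l -> p != q ->
        V p q = (V k l + V l k) / ((n%:R - 2) * (n%:R - 3))].
Proof.
move=> n4 kl Vz Vi q qk ql.
have n4R : 4 <= n%:R :> R by rewrite ler_nat.
have n2 : n%:R - 2 != 0 :> R by apply/eqP; lra.
have n3 : n%:R - 3 != 0 :> R by apply/eqP; lra.
have lk : l != k by rewrite eq_sym.
have Vi' := stab_inv_sym Vi.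
have Vt := zero_sum_tr Vz.
have e1 q' : q' != k -> q' != l -> V k q' = - V k l / (n%:R - 2).
  by move=> h1 h2; rewrite -(stab_inv_row kl Vz Vi h1 h2); field.
have e2 q' : q' != k -> q' != l -> V l q' = - V l k / (n%:R - 2).
  by move=> h1 h2; rewrite -(stab_inv_row lk Vz Vi' h2 h1); field.
have e3 q' : q' != k -> q' != l -> V q' l = - V k l / (n%:R - 2).
  move=> h1 h2; have := stab_inv_row lk Vt
    (stab_inv_tr Vi') h2 h1.
  by rewrite !mxE => <-; field.
have e4 q' : q' != k -> q' != l -> V q' k = - V l k / (n%:R - 2).
  move=> h1 h2; have := stab_inv_row kl Vt
    (stab_inv_tr Vi) h1 h2.
  by rewrite !mxE => <-; field.
split; [exact: e1 | exact: e3 | exact: e2 | exact: e4 |] => p pk pl pq.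
have := stab_inv_out kl Vz Vi pk pl qk ql pq.
rewrite e3 // e4 // => h.
apply: (mulfI n3); rewrite h; field.
by apply/andP.
Qed.

(** Zero row sums of [A] allow a constant to be subtracted from each row of [V], chosen so that only
    the columns [k] and [l] survive; zero column sums of [A] then collapse the sum over the rows. *)
Lemma zero_sum_pairing (R : realFieldType) (n : nat) (A V : 'M[R]_n)
    (k l : 'I_n) : (4 <= n)%N -> k != l -> zero_sum A ->
  zero_sum V -> stab_inv V k l ->
  \sum_p \sum_q A p q * V p q =
  (A k l * V k l + A l k * V l k) * (n%:R / (n%:R - 2)) +
  (A k l + A l k) * (V k l + V l k) / ((n%:R - 2) * (n%:R - 3)).
Proof.
move=> n4 kl [Ar Ac Ad] Vz Vi; have lk : l != k by rewrite eq_sym.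
have n4R : 4 <= n%:R :> R by rewrite ler_nat.
have n2 : n%:R - 2 != 0 :> R by apply/eqP; lra.
have n3 : n%:R - 3 != 0 :> R by apply/eqP; lra.
pose c := - V k l / (n%:R - 2); pose c' := - V l k / (n%:R - 2).
pose w := (V k l + V l k) / ((n%:R - 2) * (n%:R - 3)).
have ent := stab_inv_entries n4 kl Vz Vi.
have shift p d : \sum_q A p q * V p q = \sum_q A p q * (V p q - d).
  have h : \sum_q A p q * d = 0 by rewrite -mulr_suml Ar mul0r.
  rewrite -[LHS]subr0 -[X in _ - X]h -sumrB.
  by apply: eq_bigr => q _; ring.
have rk : \sum_q A k q * V k q = A k l * (V k l - c).
  rewrite (shift k c) (sum_off2 k l 0) // => [|q qk ql].
    by rewrite Ad; ring.
  by have [-> _ _ _ _] := ent q qk ql; rewrite subrr mulr0.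
have rl : \sum_q A l q * V l q = A l k * (V l k - c').
  rewrite (shift l c') (sum_off2 k l 0) // => [|q qk ql].
    by rewrite Ad; ring.
  by have [_ _ -> _ _] := ent q qk ql; rewrite subrr mulr0.
have rp p : p != k -> p != l ->
    \sum_q A p q * V p q = A p k * (c' - w) + A p l * (c - w).
  move=> pk pl; have [_ el _ ek _] := ent p pk pl.
  rewrite (shift p w) (sum_off3 p k l 0) // => [|q qp qk ql].
    by rewrite Ad el ek /c /c'; ring.
  have [_ _ _ _ out] := ent q qk ql.
  by rewrite (out p pk pl) ?subrr ?mulr0 // eq_sym.
have colE j e : \sum_(p | (p != k) && (p != l)) A p j * e =
    - (A k j + A l j) * e.
  rewrite -mulr_suml; congr (_ * _).
  have := Ac j; rewrite (bigD1 k) //= (bigD1 l) //= addrA => /eqP.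
  by rewrite addrC addr_eq0 => /eqP.
rewrite (bigD1 k) //= rk (bigD1 l) //= rl.
rewrite (eq_bigr (fun p => A p k * (c' - w) + A p l * (c - w))); last first.
  by move=> p /andP[]; apply: rp.
rewrite big_split /= !colE !Ad /c /c' /w; field.
by apply/andP.
Qed.

(** * Test functions *)

(** [b = false] gives the symmetric part and [b = true] the antisymmetric part, so that one argument
    treats both. *)
Definition part (R : realFieldType) (n : nat) (b : bool) (A : 'M[R]_n) :
    'M[R]_n :=
  \matrix_(i, j) ((A i j + (-1) ^+ b * A j i) / 2).

Definition norm1 (R : realFieldType) (n : nat) (A : 'M[R]_n) : R :=
  \sum_i \sum_j `|A i j|.

Lemma norm1_ge0 (R : realFieldType) (n : nat) (A : 'M[R]_n) : 0 <= norm1 A.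
Proof. by apply: sumr_ge0 => i _; apply: sumr_ge0. Qed.

Lemma part_tr (R : realFieldType) (n : nat) (b : bool) (A : 'M[R]_n)
    (i j : 'I_n) :
  part b A j i = (-1) ^+ b * part b A i j.
Proof. by rewrite !mxE; case: b; rewrite ?expr0 ?expr1; field. Qed.

Lemma zero_sum_part (R : realFieldType) (n : nat) (b : bool) (A : 'M[R]_n) :
  zero_sum A -> zero_sum (part b A).
Proof.
case=> Ar Ac Ad; split=> [i|j|i]; last by rewrite !mxE Ad mulr0 addr0 mul0r.
  under eq_bigr do rewrite mxE.
  by rewrite -mulr_suml big_split /= -mulr_sumr Ar Ac mulr0 addr0 mul0r.
under eq_bigr do rewrite mxE.
by rewrite -mulr_suml big_split /= -mulr_sumr Ar Ac mulr0 addr0 mul0r.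
Qed.

Lemma sum_transpose (R : realFieldType) (n : nat) (f : 'I_n -> 'I_n -> R) :
  \sum_i \sum_j f i j = 2^-1 * \sum_i \sum_j (f i j + f j i).
Proof.
have -> : \sum_i \sum_j (f i j + f j i) =
    \sum_i \sum_j f i j + \sum_i \sum_j f i j.
  rewrite [X in _ = _ + X]exchange_big -big_split /=.
  by apply: eq_bigr => i _; rewrite -big_split.
by field.
Qed.

(** Averaging each term with its transpose cancels the mixed products of symmetric and antisymmetric
    parts. *)
Lemma bil_parts (R : realFieldType) (n : nat) (A B : 'M[R]_n) (s : 'S_n) :
  bil A B s = bil (part false A) (part false B) s +
              bil (part true A) (part true B) s.
Proof.
rewrite /bil -big_split /=; under [RHS]eq_bigr do rewrite -big_split /=.
rewrite sum_transpose [RHS]sum_transpose; congr (_ * _).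
apply: eq_bigr => i _; apply: eq_bigr => j _.
by rewrite !mxE expr0 expr1; field.
Qed.

(** The sign matrix of a part has the symmetry of that part, so its pairing with the other part of
    [B] vanishes. *)
Lemma sum_part_sg (R : realFieldType) (n : nat) (b : bool) (B : 'M[R]_n) :
  \sum_i \sum_j B i j * Num.sg (part b B i j) = norm1 (part b B).
Proof.
rewrite sum_transpose /norm1 mulr_sumr; apply: eq_bigr => i _.
rewrite mulr_sumr; apply: eq_bigr => j _.
rewrite normrEsg (part_tr b B i j) sgrM !mxE.
by case: b; rewrite ?expr0 ?expr1 ?sgrN ?sgr1; field.
Qed.

(** The coefficient of [V k l * (2 * part b A k l)] in [zero_sum_pairing] when
    [V l k = (-1) ^+ b * V k l]. *)
Definition test_const (R : realFieldType) (n : nat) (b : bool) : R :=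
  n%:R / (n%:R - 2) + (1 + (-1) ^+ b) / ((n%:R - 2) * (n%:R - 3)).

Lemma test_const_ge1 (R : realFieldType) (n : nat) (b : bool) : (4 <= n)%N ->
  1 <= test_const R n b.
Proof.
move=> n4; have n4R : 4 <= n%:R :> R by rewrite ler_nat.
have h : 1 <= n%:R / (n%:R - 2) :> R by rewrite ler_pdivlMr; lra.
rewrite /test_const (le_trans h) // lerDl divr_ge0 //.
  by case: b; rewrite ?expr0 ?expr1; lra.
by apply: mulr_ge0; lra.
Qed.

Lemma sum_offdiag (R : realFieldType) (n : nat) (f : 'I_n -> 'I_n -> R) :
  (forall i, f i i = 0) ->
  \sum_i \sum_(j | j != i) f i j = \sum_i \sum_j f i j.
Proof.
by move=> f0; apply: eq_bigr => i _; rewrite [RHS](bigD1 i) //= f0 add0r.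
Qed.

(** Testing against the sign of one entry of a part of [B] reads off one entry of [A]. The
    correlations of [B] with the test form a zero-sum matrix invariant under the stabilizer of [k]
    and [l], so [zero_sum_pairing] applies, and [sum_perm_pair] supplies its two free entries. *)
Lemma bil_test (R : realFieldType) (n : nat) (b : bool) (A B : 'M[R]_n)
    (k l : 'I_n) : (4 <= n)%N -> k != l -> zero_sum A -> zero_sum B ->
  \sum_(s : 'S_n) bil A B s * Num.sg (part b B (s k) (s l)) =
  (n.-2)`!%:R * norm1 (part b B) * (2 * part b A k l) * test_const R n b.
Proof.
move=> n4 kl Az Bz; have [Br Bc Bd] := Bz.
pose g i j := Num.sg (part b B i j).
pose V : 'M[R]_n := \matrix_(p, q) \sum_(s : 'S_n) B (s p) (s q) * g (s k) (s l).
have -> : \sum_(s : 'S_n) bil A B s * Num.sg (part b B (s k) (s l)) =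
    \sum_p \sum_q A p q * V p q.
  rewrite /bil; under eq_bigr do rewrite mulr_suml.
  rewrite exchange_big; apply: eq_bigr => p _.
  under eq_bigr do rewrite mulr_suml.
  rewrite exchange_big; apply: eq_bigr => q _.
  by rewrite mxE mulr_sumr; apply: eq_bigr => s _; rewrite mulrA.
have reix (s : 'S_n) (f : 'I_n -> R) : \sum_q f (s q) = \sum_q f q.
  by rewrite [RHS](reindex_inj (@perm_inj _ s)).
have Vz : zero_sum V.
  split=> [p|q|p].
  - under eq_bigr do rewrite mxE.
    rewrite exchange_big big1 //= => s _.
    by rewrite -mulr_suml (reix s (B (s p))) Br mul0r.
  - under eq_bigr do rewrite mxE.
    rewrite exchange_big big1 //= => s _.
    by rewrite -mulr_suml (reix s (B^~ (s q))) Bc mul0r.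
  - by rewrite mxE big1 // => s _; rewrite Bd mul0r.
have Vi : stab_inv V k l.
  move=> p pk pl i j; rewrite !mxE [RHS](reindex_inj (mulgI p)).
  by apply: eq_bigr => s _; rewrite !permM pk pl.
have Vkl : V k l = (n.-2)`!%:R * norm1 (part b B).
  rewrite mxE (sum_perm_pair (fun i j => B i j * g i j) kl) sum_offdiag.
    by rewrite sum_part_sg.
  by move=> i; rewrite Bd mul0r.
have Vlk : V l k = (-1) ^+ b * V k l.
  rewrite mxE (sum_perm_pair (fun i j => B j i * g i j) kl) sum_offdiag; last first.
    by move=> i; rewrite Bd mul0r.
  rewrite exchange_big Vkl mulrCA; congr (_ * _).
  rewrite -sum_part_sg mulr_sumr; apply: eq_bigr => i _.
  rewrite mulr_sumr; apply: eq_bigr => j _.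
  rewrite /g (part_tr b B i j) sgrM mulrCA; congr (_ * _).
  by case: b {g V Vz Vi Vkl}; rewrite ?expr0 ?expr1 ?sgrN ?sgr1.
rewrite (zero_sum_pairing n4 kl Az Vz Vi) Vlk Vkl !mxE /test_const.
have n4R : 4 <= n%:R :> R by rewrite ler_nat.
have n2 : n%:R - 2 != 0 :> R by apply/eqP; lra.
have n3 : n%:R - 3 != 0 :> R by apply/eqP; lra.
by case: b {g V Vz Vi Vkl Vlk}; rewrite ?expr0 ?expr1; field; apply/andP.
Qed.

(** Each term of [bil] sees the images of two points only. Reindexing by a permutation that fixes
    these points, and under which [h] is odd, sends its correlation with [h] to the negative. *)
Lemma bil_sum_vanish (R : realFieldType) (n : nat) (A B : 'M[R]_n)
    (h : 'S_n -> R) :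
  (forall p q, exists2 t : 'S_n, t p = p /\ t q = q &
     forall s, h (t * s)%g = - h s) ->
  \sum_(s : 'S_n) bil A B s * h s = 0.
Proof.
move=> hyp; rewrite /bil; under eq_bigr do rewrite mulr_suml.
rewrite exchange_big big1 //= => p _.
under eq_bigr do rewrite mulr_suml.
rewrite exchange_big big1 //= => q _.
have [t [tp tq] ht] := hyp p q.
set X := LHS; suff : X = - X by move=> /eqP; rewrite -addr_eq0; lra.
rewrite [LHS](reindex_inj (mulgI t)) -sumrN; apply: eq_bigr => s _.
by rewrite !permM tp tq ht mulrN.
Qed.

(* [riesz lam s k] is the pair of real and imaginary parts of the Riesz product
   of the [1 + i lam s_r] over [r < k]. *)
Fixpoint riesz (R : realFieldType) (T : Type) (lam : R) (s : nat -> T -> R)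
    (k : nat) (w : T) : R * R :=
  if k is k'.+1 then
    let: (P, Q) := riesz lam s k' w in
    (P - lam * s k' w * Q, Q + lam * s k' w * P)
  else (1, 0).

Lemma rieszS1 (R : realFieldType) (T : Type) (lam : R) (s : nat -> T -> R)
    (k : nat) (w : T) : (riesz lam s k.+1 w).1 =
  (riesz lam s k w).1 - lam * s k w * (riesz lam s k w).2.
Proof. by rewrite /=; case: (riesz lam s k w). Qed.

Lemma rieszS2 (R : realFieldType) (T : Type) (lam : R) (s : nat -> T -> R)
    (k : nat) (w : T) : (riesz lam s k.+1 w).2 =
  (riesz lam s k w).2 + lam * s k w * (riesz lam s k w).1.
Proof. by rewrite /=; case: (riesz lam s k w). Qed.

(** Multiplicativity of the squared modulus. *)
Lemma riesz_sqr (R : realFieldType) (T : Type) (lam : R) (s : nat -> T -> R)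
    (k : nat) (w : T) :
  (riesz lam s k w).1 ^+ 2 + (riesz lam s k w).2 ^+ 2 =
  \prod_(r < k) (1 + (lam * s r w) ^+ 2).
Proof.
elim: k => [|k IH]; first by rewrite big_ord0 /=; ring.
by rewrite big_ord_recr -IH rieszS1 rieszS2 /=; ring.
Qed.

(** The imaginary part of the product has only terms of odd degree. Those of degree one give the
    right-hand side; the others are grouped by their three largest indices, the lower factors
    contributing a real part, and vanish by hypothesis. *)
Lemma riesz_sum (R : realFieldType) (T : finType) (lam : R)
    (s : nat -> T -> R) (t : nat) (F : T -> R) :
  (forall k j m, (m < j)%N -> (j < k)%N -> (k < t)%N ->
     \sum_w F w * (s k w * s j w * s m w * (riesz lam s m w).1) = 0) ->
  \sum_w F w * (riesz lam s t w).2 = lam * \sum_(r < t) \sum_w F w * s r w.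
Proof.
move=> van.
have two k j m : (j < k)%N -> (k < t)%N -> (m <= j)%N ->
    \sum_w F w * (s k w * s j w * (riesz lam s m w).2) = 0.
  move=> jk kt; elim: m => [|m IH] mj.
    by rewrite big1 // => w _; rewrite !mulr0.
  under eq_bigr do rewrite rieszS2.
  rewrite -[RHS](addr0 0) -[X in _ = X + _](IH (ltnW mj)).
  rewrite -[X in _ = _ + X](mulr0 lam) -[X in _ = _ + _ * X](van k j m mj jk kt).
  rewrite mulr_sumr -big_split /=; apply: eq_bigr => w _; ring.
have one k m : (k < t)%N -> (m <= k)%N ->
    \sum_w F w * (s k w * (riesz lam s m w).1) = \sum_w F w * s k w.
  move=> kt; elim: m => [|m IH] mk.
    by apply: eq_bigr => w _; rewrite mulr1.
  rewrite -(IH (ltnW mk)); under eq_bigr do rewrite rieszS1.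
  rewrite -[RHS]subr0 -[X in _ = _ - X](mulr0 lam).
  rewrite -[X in _ = _ - _ * X](two k m m mk kt (leqnn m)).
  rewrite mulr_sumr -sumrB; apply: eq_bigr => w _; ring.
have main m : (m <= t)%N -> \sum_w F w * (riesz lam s m w).2 =
    lam * \sum_(r < m) \sum_w F w * s r w.
  elim: m => [|m IH] mt.
    by rewrite big_ord0 mulr0 big1 // => w _; rewrite mulr0.
  rewrite big_ord_recr /= mulrDr -(IH (ltnW mt)) -(one m m mt (leqnn m)).
  rewrite mulr_sumr -big_split /=; apply: eq_bigr => w _.
  by case: (riesz lam s m w) => P Q /=; ring.
exact: main.
Qed.

(** Bounding the [tau ^ 2] correlations one by one would give a factor [tau ^ 2]. With
    [lam = 1 / tau] the Riesz product stays bounded while its linear part is multiplied by [lam]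
    only, which saves a factor [tau]. *)
Lemma riesz_bound (R : realType) (T : finType) (tau : nat)
    (s : nat -> T -> R) (F : T -> R) : (0 < tau)%N ->
  (forall r w, `|s r w| <= 1) ->
  (forall k j m, (m < j)%N -> (j < k)%N -> (k < tau ^ 2)%N ->
     \sum_w F w * (s k w * s j w * s m w * (riesz tau%:R^-1 s m w).1) = 0) ->
  \sum_(r < tau ^ 2) \sum_w F w * s r w <= tau%:R * expR 1 * \sum_w `|F w|.
Proof.
move=> tau0 s1 van; have tauR : 0 < tau%:R :> R by rewrite ltr0n.
set t := (tau ^ 2)%N in van *; set lam := tau%:R^-1 in van *.
have lam0 : 0 < lam by rewrite invr_gt0.
have tlam : t%:R * lam ^+ 2 = 1 :> R.
  by rewrite /t natrX /lam exprVn mulfV // expf_neq0 // gt_eqF.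
(* The squared modulus is at most [(1 + lam ^+ 2) ^+ t], hence at most [expR 1]. *)
have Q1 w : `|(riesz lam s t w).2| <= expR 1.
  have e1 : 1 <= expR 1 :> R by rewrite -[leLHS]expR0 ler_expR.
  rewrite -(ler_pXn2r (n := 2)) ?nnegrE ?(le_trans ler01 e1) //.
  rewrite -normrX ger0_norm ?sqr_ge0 //.
  apply: (@le_trans _ _ (expR 1)); last by rewrite expr2 ler_peMl // expR_ge0.
  apply: (@le_trans _ _ (\prod_(r < t) (1 + (lam * s r w) ^+ 2))).
    by rewrite -riesz_sqr lerDr sqr_ge0.
  apply: (@le_trans _ _ (\prod_(r < t) expR (lam ^+ 2))).
    apply: ler_prod => r _; apply/andP; split; first by rewrite addr_ge0 ?sqr_ge0.
    apply: le_trans (expR_ge1Dx _); rewrite lerD2l exprMn ler_piMr ?sqr_ge0 //.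
    by rewrite -real_normK ?num_real // exprn_ile1 ?normr_ge0.
  by rewrite prodr_const card_ord -expRM_natl mulr_natl -mulr_natl tlam.
have : \sum_w F w * (riesz lam s t w).2 <= expR 1 * \sum_w `|F w|.
  rewrite mulr_sumr; apply: ler_sum => w _.
  apply: le_trans (ler_norm _) _; rewrite normrM mulrC.
  by apply: ler_wpM2r.
rewrite (riesz_sum van) -ler_pdivlMl // invrK => h.
by rewrite -mulrA.
Qed.

(* A triple [(z, x, y)] stands for the transposition of [x] and [y], tested
   against the entries [(z, x)] and [(z, y)]. *)
Definition swap_ok (n : nat) (u : 'I_n * 'I_n * 'I_n) : bool :=
  [&& u.1.1 != u.1.2, u.1.1 != u.2 & u.1.2 != u.2].

(** Only the moved points of [u] have to avoid [v]; two triples may share their base point [z], as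
    happens when all triples come from one row. *)
Definition swap_free (n : nat) (u v : 'I_n * 'I_n * 'I_n) : bool :=
  [&& u.1.2 != v.1.1, u.1.2 != v.1.2, u.1.2 != v.2, u.2 != v.1.1,
      u.2 != v.1.2 & u.2 != v.2].

Lemma normr_sg_le1 (R : realFieldType) (x : R) : `|Num.sg x| <= 1.
Proof. by rewrite normr_sg; case: (x != 0). Qed.

Lemma tperm_fixes (n : nat) (x y p : 'I_n) : p != x -> p != y ->
  tperm x y p = p.
Proof. by move=> px py; rewrite tpermD // eq_sym. Qed.

(* Each of [p] and [q] is moved by at most one of three disjoint
   transpositions. *)
Lemma disjoint_swaps (n : nat) (u v w : 'I_n * 'I_n * 'I_n) (p q : 'I_n) :
  swap_free u v -> swap_free u w -> swap_free v w ->
  [\/ tperm u.1.2 u.2 p = p /\ tperm u.1.2 u.2 q = q,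
      tperm v.1.2 v.2 p = p /\ tperm v.1.2 v.2 q = q
    | tperm w.1.2 w.2 p = p /\ tperm w.1.2 w.2 q = q].
Proof.
move=> /and5P[_ a1 a2 _ /andP[a3 a4]] /and5P[_ b1 b2 _ /andP[b3 b4]] /and5P[_ c1 c2 _ /andP[c3 c4]].
pose moved (t : 'I_n * 'I_n * 'I_n) i := (i == t.1.2) || (i == t.2).
have fixd t i : ~~ moved t i -> tperm t.1.2 t.2 i = i.
  by rewrite negb_or => /andP[]; exact: tperm_fixes.
have uv i : moved u i -> ~~ moved v i.
  by rewrite /moved negb_or; case/orP => /eqP ->; apply/andP.
have uw i : moved u i -> ~~ moved w i.
  by rewrite /moved negb_or; case/orP => /eqP ->; apply/andP.
have vw i : moved v i -> ~~ moved w i.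
  by rewrite /moved negb_or; case/orP => /eqP ->; apply/andP.
case up: (moved u p).
  case vq: (moved v q).
    by constructor 3; split; apply: fixd; [exact: uw | exact: vw].
  by constructor 2; split; apply: fixd; [exact: uv | rewrite vq].
case uq: (moved u q).
  case vp: (moved v p).
    by constructor 3; split; apply: fixd; [exact: vw | exact: uw].
  by constructor 2; split; apply: fixd; [rewrite vp | exact: uv].
by constructor 1; split; apply: fixd; rewrite ?up ?uq.
Qed.

(** The tests are antisymmetrized by pairwise disjoint transpositions, each of which leaves the
    other tests unchanged. A product of three tests is odd under three disjoint transpositions, one
    of which fixes both points seen by a term of [bil]; hence [riesz_bound] applies. *)
Lemma bil_family (R : realType) (n : nat) (b : bool) (A B : 'M[R]_n)
    (tau : nat) (w : nat -> 'I_n * 'I_n * 'I_n) :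
  (4 <= n)%N -> (0 < tau)%N -> zero_sum A -> zero_sum B ->
  (forall r, (r < tau ^ 2)%N -> swap_ok (w r)) ->
  (forall r s, (r < tau ^ 2)%N -> (s < tau ^ 2)%N -> r != s ->
     swap_free (w r) (w s)) ->
  (n.-2)`!%:R * norm1 (part b B) *
    (\sum_(r < tau ^ 2) `|part b A (w r).1.1 (w r).1.2
                          - part b A (w r).1.1 (w r).2|) <=
  tau%:R * expR 1 * \sum_(s : 'S_n) `|bil A B s|.
Proof.
move=> n4 tau0 Az Bz ok free.
pose a r := part b A (w r).1.1 (w r).1.2 - part b A (w r).1.1 (w r).2.
pose g i j := Num.sg (part b B i j).
(* The factor [2^-1] keeps the test bounded by 1, and the sign of [a r] makes its correlation a
   nonnegative multiple of the absolute value of [a r]. *)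
pose s r (sg : 'S_n) : R := 2^-1 * Num.sg (a r) *
  (g (sg (w r).1.1) (sg (w r).1.2) - g (sg (w r).1.1) (sg (w r).2)).
have s1 r sg : `|s r sg| <= 1.
  rewrite /s !normrM ger0_norm ?invr_ge0 //.
  have h1 := normr_sg_le1 (a r).
  have h2 : `|g (sg (w r).1.1) (sg (w r).1.2) - g (sg (w r).1.1) (sg (w r).2)|
      <= 2.
    by rewrite (le_trans (ler_normB _ _)) // (natrD _ 1 1) lerD ?normr_sg_le1.
  rewrite -mulrA -[leRHS](@mulVf _ 2) // ler_wpM2l ?invr_ge0 //.
  by rewrite -[leRHS]mul1r ler_pM.
have anti r sg : (r < tau ^ 2)%N ->
    s r (tperm (w r).1.2 (w r).2 * sg)%g = - s r sg.
  move=> rt; have /and3P[zx zy xy] := ok r rt.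
  by rewrite /s !permM tpermL tpermR tperm_fixes //; ring.
have invs r k sg : (r < tau ^ 2)%N -> (k < tau ^ 2)%N -> r != k ->
    s r (tperm (w k).1.2 (w k).2 * sg)%g = s r sg.
  move=> rt kt rk; have /and5P[h1 h2 h3 h4 /andP[h5 h6]] : swap_free (w k) (w r).
    by apply: free; rewrite // eq_sym.
  by rewrite /s !permM !tperm_fixes // eq_sym.
have invP k m sg lam : (k < tau ^ 2)%N -> (m <= k)%N ->
    riesz lam s m (tperm (w k).1.2 (w k).2 * sg)%g = riesz lam s m sg.
  move=> kt; elim: m => [//|m IH] mk; rewrite /= IH ?(ltnW mk) //.
  by rewrite invs ?(ltn_trans mk kt) // neq_ltn mk.
have van k j m : (m < j)%N -> (j < k)%N -> (k < tau ^ 2)%N ->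
    \sum_sg bil A B sg *
      (s k sg * s j sg * s m sg * (riesz tau%:R^-1 s m sg).1) = 0.
  move=> mj jk kt.
  have jt := ltn_trans jk kt; have mt := ltn_trans mj jt.
  have mk := ltn_trans mj jk.
  have kj' : k != j by rewrite neq_ltn jk orbT.
  have km' : k != m by rewrite neq_ltn mk orbT.
  have jm' : j != m by rewrite neq_ltn mj orbT.
  apply: bil_sum_vanish => p q.
  have [h|h|h] := disjoint_swaps p q (free k j kt jt kj') (free k m kt mt km')
    (free j m jt mt jm').
  - exists (tperm (w k).1.2 (w k).2) => // sg.
    rewrite (invP k) ?(ltnW mk) // anti // (invs j) 1?eq_sym //.
    by rewrite (invs m) 1?eq_sym //; ring.
  - exists (tperm (w j).1.2 (w j).2) => // sg.
    rewrite (invP j) ?(ltnW mj) // anti // (invs k) //.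
    by rewrite (invs m) 1?eq_sym //; ring.
  - exists (tperm (w m).1.2 (w m).2) => // sg.
    by rewrite (invP m) // anti // (invs k) // (invs j) //; ring.
apply: le_trans (riesz_bound tau0 s1 van).
rewrite mulr_sumr; apply: ler_sum => r _.
have /and3P[zx zy xy] := ok r (ltn_ord r).
have -> : \sum_sg bil A B sg * s r sg = 2^-1 * Num.sg (a r) *
    (\sum_sg bil A B sg * g (sg (w r).1.1) (sg (w r).1.2) -
     \sum_sg bil A B sg * g (sg (w r).1.1) (sg (w r).2)).
  by rewrite -sumrB mulr_sumr; apply: eq_bigr => sg _; rewrite /s; ring.
rewrite !bil_test // -mulrBl -mulrBr -mulrBr -/(a r).
set c := (n.-2)`!%:R * _.
have -> : 2^-1 * Num.sg (a r) * (c * (2 * a r) * test_const R n b) =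
    c * (Num.sg (a r) * a r) * test_const R n b by field.
rewrite -normrEsg ler_peMr ?test_const_ge1 // !mulr_ge0 //.
exact: norm1_ge0.
Qed.

(** A sign test is bounded by 1, so the sum of absolute values dominates the correlation computed in
    [bil_test]. *)
Lemma bil_single (R : realFieldType) (n : nat) (b : bool) (A B : 'M[R]_n)
    (k l : 'I_n) : (4 <= n)%N -> zero_sum A -> zero_sum B ->
  (n.-2)`!%:R * norm1 (part b B) * (2 * `|part b A k l|) <=
  \sum_(s : 'S_n) `|bil A B s|.
Proof.
move=> n4 Az Bz; have [<-|kl] := eqVneq k l.
  have [_ _ ->] := zero_sum_part b Az.
  by rewrite normr0 !mulr0; apply: sumr_ge0.
have N0 : 0 <= (n.-2)`!%:R * norm1 (part b B).
  by rewrite mulr_ge0 ?norm1_ge0.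
have c1 := test_const_ge1 R b n4.
apply: (@le_trans _ _ `|\sum_(s : 'S_n)
    bil A B s * Num.sg (part b B (s k) (s l))|).
  rewrite bil_test // normrM (ger0_norm (le_trans ler01 c1)) normrM.
  rewrite (ger0_norm N0) normrM (ger0_norm (ler0n _ 2)) ler_peMr //.
  by rewrite !mulr_ge0 ?norm1_ge0.
apply: le_trans (ler_norm_sum _ _ _) _; apply: ler_sum => s _.
by rewrite normrM ler_piMr ?normr_sg_le1.
Qed.

(** * Sparsity *)

Lemma greedy (T : Type) (Q : pred T) (c : rel T) (t : nat) :
  (forall w : seq T, (size w < t)%N -> all Q w ->
     exists2 v, Q v & all (c v) w) ->
  exists w : seq T, [/\ size w = t, all Q w & pairwise c w].
Proof.
elim: t => [|t IH] ext; first by exists [::].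
have [w|w [wt wQ wc]] := IH.
  by move=> wt; apply: ext; exact: ltnW.
have [v vQ vc] : exists2 v, Q v & all (c v) w by apply: ext; rewrite ?wt.
by exists (v :: w); rewrite /= wt vQ wQ vc wc.
Qed.

(** Otherwise [f y] has the sign of [f x] and size at least [beta / 2] for all [y] outside [U];
    these values would outweigh the at most [D * beta] lost at each point of [U], against the zero
    sum. *)
Lemma spread_row (R : realFieldType) (n : nat) (f : 'I_n -> R) (x : 'I_n)
    (U : {set 'I_n}) (beta D : R) :
  \sum_y f y = 0 -> (forall y, `|f y| <= D * beta) -> 0 < beta ->
  beta <= `|f x| -> #|U|%:R * (1 + 2 * D) < n%:R ->
  exists2 y, y \notin U & beta / 2 <= `|f x - f y|.
Proof.
move=> f0 fD b0 fx nU.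
case: (pselect (exists2 y, y \notin U & beta / 2 <= `|f x - f y|)) => // ne.
have close y : y \notin U -> beta / 2 <= Num.sg (f x) * f y.
  move=> yU; rewrite leNgt; apply/negP => h; apply: ne; exists y => //.
  move: fx h; have [fx0|fx0|->] := ltrgt0P (f x).
  - rewrite gtr0_sg // mul1r => h1 h2.
    by apply: le_trans (ler_norm _); lra.
  - rewrite ltr0_sg // mulN1r => h1 h2.
    by rewrite distrC; apply: le_trans (ler_norm _); lra.
  - by rewrite leNgt b0.
have D0 : 0 <= D.
  by have := le_trans (normr_ge0 _) (fD x); rewrite pmulr_lge0.
have : 0 = \sum_y Num.sg (f x) * f y by rewrite -mulr_sumr f0 mulr0.
rewrite (bigID (mem U)) /=.
have h1 : - (#|U|%:R * (D * beta)) <= \sum_(y in U) Num.sg (f x) * f y.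
  rewrite -mulrN mulr_natl -sumr_const; apply: ler_sum => y _.
  rewrite lerNl; apply: le_trans (ler_norm _) _.
  rewrite normrN normrM; apply: le_trans (fD y).
  by rewrite ler_piMl ?normr_sg_le1.
have h2 : (n%:R - #|U|%:R) * (beta / 2) <=
    \sum_(y | y \notin U) Num.sg (f x) * f y.
  apply: (@le_trans _ _ (\sum_(y | y \notin U) beta / 2)); last exact: ler_sum.
  rewrite (eq_bigl (fun y => y \in ~: U)) => [|y]; last by rewrite inE.
  have cU : #|~: U| = (n - #|U|)%N by rewrite cardsCs finset.setCK card_ord.
  rewrite sumr_const cU -[leRHS]mulr_natl natrB //.
  by rewrite -[X in (_ <= X)%N](card_ord n) max_card.
move=> sum0; have := nU; rewrite -subr_gt0 => nU'; have := mulr_gt0 b0 nU'; nra.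
Qed.

Definition swap_indep (n : nat) (u v : 'I_n * 'I_n * 'I_n) : bool :=
  swap_free u v && swap_free v u.

Definition swap_verts (n : nat) (w : seq ('I_n * 'I_n * 'I_n)) : {set 'I_n} :=
  [set i | has (fun u => [|| i == u.1.1, i == u.1.2 | i == u.2]) w].

Lemma card_swap_verts (n : nat) (w : seq ('I_n * 'I_n * 'I_n)) :
  (#|swap_verts w| <= 3 * size w)%N.
Proof.
elim: w => [|u w IH] /=.
  by rewrite (_ : swap_verts _ = finset.set0) ?cards0 //; apply/setP => i; rewrite !inE.
have -> : swap_verts (u :: w) = [set u.1.1; u.1.2; u.2] :|: swap_verts w.
  by apply/setP => i; rewrite !inE /= !orbA.
rewrite mulnS (leq_trans (leq_card_setU _ _)) // leq_add //.
rewrite (leq_trans (leq_card_setU _ _)) // cards1 addn1 ltnS.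
by rewrite cards2; case: (_ != _).
Qed.

Lemma notin_swap_verts (n : nat) (w : seq ('I_n * 'I_n * 'I_n)) (i : 'I_n) :
  i \notin swap_verts w ->
  forall u, u \in w -> [/\ i != u.1.1, i != u.1.2 & i != u.2].
Proof.
rewrite inE => /hasPn h u uw; have := h u uw.
by rewrite !negb_or => /and3P.
Qed.

Definition swap_gap (R : realFieldType) (n : nat) (X : 'M[R]_n) (beta : R)
    (u : 'I_n * 'I_n * 'I_n) : bool :=
  swap_ok u && (beta / 2 <= `|X u.1.1 u.1.2 - X u.1.1 u.2|).

(** A family that cannot be extended confines the large entries. In one row this leaves at most
    [3 * t] of them; over the whole matrix, every large entry has its row or its column among at
    most [3 * t] indices. Together these give [2 * (3 * t) ^ 2]. *)
Lemma sparse_or_family (R : realFieldType) (n : nat) (X : 'M[R]_n) (t : nat)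
    (beta D : R) :
  zero_sum X -> (forall i j, `|X j i| = `|X i j|) -> 0 < beta ->
  (forall i j, `|X i j| <= D * beta) ->
  (3 * t + 2)%:R * (1 + 2 * D) < n%:R ->
  (exists w, [/\ size w = t, all (swap_gap X beta) w
               & pairwise (@swap_indep n) w]) \/
  (#|[set p : 'I_n * 'I_n | (beta <= `|X p.1 p.2|)%R]| <= 18 * t ^ 2)%N.
Proof.
move=> [Xr _ Xd] Xs b0 XD nt.
case: (pselect (exists w, [/\ size w = t, all (swap_gap X beta) w
               & pairwise (@swap_indep n) w])) => [|nofam]; [by left|right].
(* [spread_row] is applied with [z] and [x] added to [U], which accounts for [3 * t + 2]. *)
have find_y z x (U : {set 'I_n}) : (#|U| <= 3 * t)%N -> beta <= `|X z x| ->
    exists y, y \notin U /\ swap_gap X beta (z, x, y).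
  move=> Ut zx; have D0 : 0 <= D.
    by have := le_trans (normr_ge0 _) (XD z x); rewrite pmulr_lge0.
  have [|y yU gap] := @spread_row _ _ (X z) x ([set z; x] :|: U) beta D
    (Xr z) (XD z) b0 zx.
    apply: le_lt_trans nt; rewrite ler_wpM2r ?addr_ge0 ?mulr_ge0 // ler_nat.
    rewrite (leq_trans (leq_card_setU _ _)) // addnC leq_add //.
    by rewrite cards2; case: (_ != _).
  exists y; move: yU; rewrite !inE !negb_or => /andP[/andP[yz yx] yU].
  split=> //; rewrite /swap_gap /swap_ok /= gap andbT eq_sym.
  rewrite [z == y]eq_sym yz [x == y]eq_sym yx !andbT.
  by apply: contraTneq zx => ->; rewrite Xd normr0 -ltNge.
(* A greedy choice within a class [Q] of gapped triples must stop before [t] steps, at a maximal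
   family. *)
have stuck (Q : pred ('I_n * 'I_n * 'I_n)) : subpred Q (swap_gap X beta) ->
    exists w, [/\ (size w < t)%N, all Q w &
      forall v, Q v -> ~~ all (swap_indep v) w].
  move=> Qg; apply: contrapT => no; apply: nofam.
  have [w wt wQ|w [wt wQ wc]] := @greedy _ Q (@swap_indep n) t.
    apply: contrapT => nov; apply: no; exists w; split=> // v vQ.
    by apply/negP => vc; apply: nov; exists v.
  by exists w; split=> //; apply: sub_all wQ.
have row_small d : (#|[set x | (beta <= `|X d x|)%R]| <= 3 * t)%N.
  have [|w [wt wQ wmax]] := stuck (fun v => swap_gap X beta v && (v.1.1 == d)).
    by move=> v /andP[].
  (* Adding [d] costs one point, and [1 + 3 * size w] is still at most [3 * t] because
     [size w < t]. *)
  apply: (@leq_trans #|d |: swap_verts w|).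
    apply/subset_leq_card/fintype.subsetP => x; rewrite inE => dx.
    apply: contraT; rewrite finset.in_setU1 negb_or => /andP[xd xw].
    have [|y [yw gap]] := find_y d x (swap_verts w) _ dx.
      by rewrite (leq_trans (card_swap_verts w)) // leq_mul2l /= ltnW.
    have := wmax (d, x, y); rewrite gap eqxx => /(_ isT) /negP[].
    apply/allP => u uw.
    have [x1 x2 x3] := notin_swap_verts xw uw.
    have [y1 y2 y3] := notin_swap_verts yw uw.
    have /andP[/andP[/and3P[u1 u2 _] _] /eqP ud] := allP wQ u uw.
    rewrite /swap_indep /swap_free /= x1 x2 x3 y1 y2 y3 /=.
    rewrite ![_ == d]eq_sym -ud u1 u2 ![_ == x]eq_sym x2 x3.
    by rewrite ![_ == y]eq_sym y2 y3.
  rewrite cardsU1 (leq_trans (leq_add (leq_b1 _) (card_swap_verts w))) //.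
  by rewrite (leq_trans _ (_ : (3 * (size w).+1 <= _)%N)) ?leq_mul2l // mulnS leq_add2r.
have [//|w [wt wQ wmax]] := stuck (swap_gap X beta).
set C := swap_verts w.
have Ct : (#|C| <= 3 * t)%N.
  by rewrite (leq_trans (card_swap_verts w)) // leq_mul2l /= ltnW.
have cover z x : beta <= `|X z x| -> (z \in C) || (x \in C).
  move=> zx; apply: contraT; rewrite negb_or => /andP[zw xw].
  have [y [yw gap]] := find_y z x C Ct zx.
  have := wmax (z, x, y) gap => /negP[]; apply/allP => u uw.
  have [x1 x2 x3] := notin_swap_verts xw uw.
  have [y1 y2 y3] := notin_swap_verts yw uw.
  have [z1 z2 z3] := notin_swap_verts zw uw.
  rewrite /swap_indep /swap_free /= x1 x2 x3 y1 y2 y3 /=.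
  rewrite ![_ == z]eq_sym z2 z3 ![_ == x]eq_sym x2 x3.
  by rewrite ![_ == y]eq_sym y2 y3.
pose S := [set p : 'I_n * 'I_n | (p.1 \in C) && (beta <= `|X p.1 p.2|)].
pose S' := [set p : 'I_n * 'I_n | (p.2 \in C) && (beta <= `|X p.1 p.2|)].
have St : (#|S| <= 3 * t * (3 * t))%N.
  rewrite -sum1_card (eq_bigl (fun p : 'I_n * 'I_n =>
    (p.1 \in C) && (beta <= `|X p.1 p.2|))) => [|p]; last by rewrite inE.
  rewrite -(pair_big_dep (mem C) (fun i j => beta <= `|X i j|) (fun _ _ => 1%N)).
  apply: (@leq_trans (\sum_(i in C) 3 * t)); last by rewrite sum_nat_const leq_mul2r Ct orbT.
  apply: leq_sum => i _; apply: leq_trans (row_small i).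
  by rewrite -sum1_card; under [X in (_ <= X)%N]eq_bigl do rewrite inE.
have S't : (#|S'| <= 3 * t * (3 * t))%N.
  rewrite -sum1_card (eq_bigl (fun p : 'I_n * 'I_n =>
    (p.2 \in C) && (beta <= `|X p.1 p.2|))) => [|p]; last by rewrite inE.
  rewrite -(pair_big_dep predT (fun i j => (j \in C) && (beta <= `|X i j|)) (fun _ _ => 1%N)).
  rewrite (exchange_big_dep (mem C)) /=; last by move=> i j _ /andP[].
  apply: (@leq_trans (\sum_(i in C) 3 * t)); last by rewrite sum_nat_const leq_mul2r Ct orbT.
  apply: leq_sum => j jC; apply: leq_trans (row_small j).
  rewrite -sum1_card (eq_bigl (fun i => beta <= `|X i j|)); last first.
    by move=> i; rewrite jC.
  by rewrite [X in (_ <= X)%N](eq_bigl (fun i => beta <= `|X i j|)) // => i; rewrite inE Xs.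
apply: (@leq_trans #|S :|: S'|).
  apply/subset_leq_card/fintype.subsetP => -[i j]; rewrite finset.in_set /= => h.
  by case/orP: (cover i j h) => hc; apply/finset.setUP; [left | right];
    rewrite finset.in_set /= hc h.
rewrite (leq_trans (leq_card_setU _ _)) //.
by rewrite (leq_trans (leq_add St S't)) // -!mulnn; lia.
Qed.

Lemma bil_inv (R : realFieldType) (n : nat) (A B : 'M[R]_n) (s : 'S_n) :
  bil B A s = bil A B s^-1%g.
Proof.
rewrite /bil [RHS](reindex_inj (@perm_inj _ s)); apply: eq_bigr => i _.
rewrite [RHS](reindex_inj (@perm_inj _ s)); apply: eq_bigr => j _.
by rewrite !permK mulrC.
Qed.

(** Exchanging [A] and [B] inverts the permutation, so the entry bounds also hold with the roles
    reversed. *)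
Lemma sum_bil_swap (R : realFieldType) (n : nat) (A B : 'M[R]_n) :
  \sum_(s : 'S_n) `|bil B A s| = \sum_(s : 'S_n) `|bil A B s|.
Proof.
rewrite [RHS](reindex_inj invg_inj); apply: eq_bigr => s _.
by rewrite bil_inv.
Qed.

(** The at most [m] entries of [X] reaching [beta] contribute at most [c] each, and the remaining
    ones at most [beta * norm1 Y] together. *)
Lemma bil_le_norm1 (R : realFieldType) (n : nat) (X Y : 'M[R]_n)
    (beta c : R) (m : nat) (s : 'S_n) :
  0 <= beta -> 0 <= c ->
  (#|[set p : 'I_n * 'I_n | (beta <= `|X p.1 p.2|)%R]| <= m)%N ->
  (forall i j k l, `|X i j| * `|Y k l| <= c) ->
  `|bil X Y s| <= m%:R * c + beta * norm1 Y.
Proof.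
move=> b0 c0 bigm XYc.
have reix (f : 'I_n -> R) : \sum_q f (s q) = \sum_q f q.
  by rewrite [RHS](reindex_inj (@perm_inj _ s)).
apply: (@le_trans _ _ (\sum_i \sum_j ((beta <= `|X i j|)%R%:R * c +
    beta * `|Y (s i) (s j)|))).
  apply: le_trans (ler_norm_sum _ _ _) _; apply: ler_sum => i _.
  apply: le_trans (ler_norm_sum _ _ _) _; apply: ler_sum => j _.
  rewrite normrM; case: (lerP beta `|X i j|) => h.
    by rewrite mul1r (le_trans (XYc _ _ (s i) (s j))) // lerDl mulr_ge0.
  by rewrite mul0r add0r ler_wpM2r // ltW.
under eq_bigr do rewrite big_split /=.
rewrite big_split /= lerD //.
  rewrite pair_big /= -mulr_suml ler_wpM2r //.
  rewrite -natr_sum ler_nat (leq_trans _ bigm) //.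
  rewrite -sum1_card [X in (_ <= X)%N]big_mkcond leq_sum // => -[i j] _.
  by rewrite finset.in_set /=; case: (_ <= _)%R.
rewrite /norm1 mulr_sumr -(reix (fun i => beta * _)) ler_sum // => i _.
by rewrite -mulr_sumr (reix (fun j => `|Y (s i) j|)).
Qed.

(* Either a part of [A] and [B] is uniformly negligible on all permutations, or
   it has bounded [l^1] mass; in the intermediate situations the Riesz products
   force the mean of [`|bil A B|] to be large. *)
Lemma bil_dichotomy (R : realType) (K kappa : R) : 0 <= K -> 0 < kappa ->
  exists2 L : R, 0 < L & exists N : nat,
  forall (n : nat) (b : bool) (A B : 'M[R]_n), (4 <= n)%N -> (N <= n)%N ->
  zero_sum A -> zero_sum B ->
  \sum_(s : 'S_n) `|bil A B s| <= K * (n.-2)`!%:R ->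
  (forall s, `|bil (part b A) (part b B) s| <= kappa) \/
  norm1 (part b A) * norm1 (part b B) <= L.
Proof.
move=> K0 kappa0.
have [k' k'0 kappaE] : exists2 k', 0 < k' & kappa = k' + k'.
  by exists (kappa / 2); [rewrite divr_gt0 | field].
(* With [beta = k' / norm1 Y], the entry bound [K / norm1 Y] becomes [D * beta]. *)
pose D := K / k'.
have D0 : 0 <= D by rewrite divr_ge0 // ltW.
(* Large enough that [tau ^ 2] gaps of size [beta / 2] contradict [bil_family]. *)
pose tau := (Num.truncn (2 * expR 1 * K / k')).+1.
have tauP : 2 * expR 1 * K / k' < tau%:R by exact: truncnS_gt.
pose t := (tau ^ 2)%N; pose m := (18 * t ^ 2)%N.
(* If the product of the norms exceeds [L], products of entries are at most [k' / m.+1], so the at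
   most [m] large entries contribute at most [k']; the small ones contribute the other [k']. *)
pose L := K ^+ 2 * m.+1%:R / k' + 1.
have L0 : 0 < L by rewrite ltr_wpDl // divr_ge0 ?mulr_ge0 ?sqr_ge0 // ltW.
exists L => //; exists (Num.truncn ((3 * t + 2)%:R * (1 + 2 * D))).+1.
move=> n b A B n4 nN Az Bz FK.
have nD : (3 * t + 2)%:R * (1 + 2 * D) < n%:R.
  by apply: lt_le_trans (truncnS_gt _) _; rewrite ler_nat.
set X := part b A; set Y := part b B.
have c20 : 0 < (n.-2)`!%:R :> R by rewrite ltr0n fact_gt0.
have HA i j : norm1 Y * (2 * `|X i j|) <= K.
  rewrite -(ler_pM2l c20) mulrA [_ * K]mulrC.
  exact: le_trans (bil_single b i j n4 Az Bz) FK.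
have HB i j : norm1 X * (2 * `|Y i j|) <= K.
  rewrite -(ler_pM2l c20) mulrA [_ * K]mulrC.
  by apply: le_trans (bil_single b i j n4 Bz Az) _; rewrite sum_bil_swap.
have [Y0|Yn0] := eqVneq (norm1 Y) 0; first by right; rewrite Y0 mulr0 ltW.
have Ypos : 0 < norm1 Y by rewrite lt_def Yn0 norm1_ge0.
have [nXY|nXY] := leP (norm1 X * norm1 Y) L; [by right|left].
pose beta := k' / norm1 Y.
have beta0 : 0 < beta by rewrite divr_gt0.
have betaY : beta * norm1 Y = k' by rewrite divfK.
have Xsym i j : `|X j i| = `|X i j|.
  by rewrite /X part_tr normrM normrX normrN1 expr1n mul1r.
have XD i j : `|X i j| <= D * beta.
  rewrite /D /beta mulrA divfK ?gt_eqF // ler_pdivlMr // mulrC.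
  by apply: le_trans (HA i j); rewrite ler_wpM2l ?norm1_ge0 // ler_peMl // ler1n.
case: (sparse_or_family (t := t) (zero_sum_part b Az) Xsym beta0 XD nD).
  move=> [w [wt /allP wg wc]]; exfalso.
  have n0 : (0 < n)%N by apply: leq_trans n4.
  pose u0 : 'I_n * 'I_n * 'I_n := (Ordinal n0, Ordinal n0, Ordinal n0).
  have wnth r : (r < t)%N -> swap_gap X beta (nth u0 w r).
    by move=> rt; apply: wg; rewrite mem_nth ?wt.
  move/(pairwiseP u0): wc => wp.
  have wfree r s : (r < t)%N -> (s < t)%N -> r != s ->
      swap_free (nth u0 w r) (nth u0 w s).
    move=> rt st; rewrite neq_ltn => /orP[] rs.
      have := wp r s; rewrite !inE wt => /(_ rt st rs).
      by case/andP.
    have := wp s r; rewrite !inE wt => /(_ st rt rs).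
    by case/andP.
  have := @bil_family R n b A B tau (nth u0 w) n4 isT Az Bz.
  move=> /(_ (fun r rt => proj1 (andP (wnth r rt))) wfree).
  apply/negP; rewrite -ltNge -/Y -/X -/t.
  apply: (@lt_le_trans _ _ ((n.-2)`!%:R * norm1 Y * (t%:R * (beta / 2)))).
    apply: (@le_lt_trans _ _ (tau%:R * expR 1 * (K * (n.-2)`!%:R))).
      by rewrite ler_wpM2l // mulr_ge0 ?expR_ge0.
    have -> : (n.-2)`!%:R * norm1 Y * (t%:R * (beta / 2)) =
        (tau%:R * (tau%:R * k') / 2) * (n.-2)`!%:R.
      by rewrite -betaY /t natrX; ring.
    rewrite mulrA ltr_pM2r // -!mulrA ltr_pM2l ?ltr0n //.
    by move: tauP; rewrite ltr_pdivrMr //; lra.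
  rewrite ler_wpM2l ?mulr_ge0 ?norm1_ge0 //.
  rewrite mulr_natl -[X in _ *+ X](card_ord t) -sumr_const.
  by apply: ler_sum => r _; have /andP[] := wnth r (ltn_ord r).
move=> bigm s.
have XYc i j k l : `|X i j| * `|Y k l| <= k' / m.+1%:R.
  rewrite -(ler_pM2r L0).
  apply: (@le_trans _ _ (`|X i j| * `|Y k l| * (norm1 X * norm1 Y))).
    by rewrite ler_wpM2l ?mulr_ge0 // ltW.
  apply: (@le_trans _ _ (K ^+ 2)).
    have -> : `|X i j| * `|Y k l| * (norm1 X * norm1 Y) =
      (norm1 Y * `|X i j|) * (norm1 X * `|Y k l|) by ring.
    rewrite expr2 ler_pM ?mulr_ge0 ?norm1_ge0 //.
      by apply: le_trans (HA i j); rewrite ler_wpM2l ?norm1_ge0 // ler_peMl // ler1n.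
    by apply: le_trans (HB k l); rewrite ler_wpM2l ?norm1_ge0 // ler_peMl // ler1n.
  have -> : k' / m.+1%:R * L = K ^+ 2 + k' / m.+1%:R.
    have : m.+1%:R != 0 :> R by rewrite pnatr_eq0.
    rewrite /L; move: m.+1%:R => M M0; field.
    by rewrite M0 gt_eqF.
  by rewrite lerDl divr_ge0 // ltW.
apply: le_trans (bil_le_norm1 s (ltW beta0) _ bigm XYc) _.
  by rewrite divr_ge0 // ltW.
rewrite betaY kappaE lerD2r mulrCA ler_piMr ?(ltW k'0) //.
by rewrite ler_pdivrMr // mul1r ler_nat leqnSn.
Qed.

(** * Heavy pairs *)

Definition fix2 (n : nat) (i j : 'I_n) : pred 'S_n :=
  fun s => (s i == i) && (s j == j).

Lemma card_fix2 (R : realFieldType) (n : nat) (i j : 'I_n) : i != j ->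
  \sum_(s | fix2 i j s) 1 = (n.-2)`!%:R :> R.
Proof.
move=> ij; rewrite big_mkcond.
have := sum_perm_pair (R := R)
  (fun k l => if (k == i) && (l == j) then 1 else 0) ij.
rewrite (bigD1 i) //= (bigD1 j) 1?eq_sym //= !eqxx.
rewrite [X in 1 + X]big1 => [|l /andP[_ /negbTE->]]; last by [].
rewrite [X in _ + X]big1 => [|k /negbTE ki]; first by rewrite !addr0 mulr1.
by rewrite big1 // => l _; rewrite ki.
Qed.

(** Among the permutations fixing [i] and [j], all [n - 2] other points have equally distributed
    images; summing over these points gives at most the full sum of [f]. *)
Lemma sum_fix2_le (R : realFieldType) (n : nat) (i j k : 'I_n)
    (f : 'I_n -> R) : i != j -> k != i -> k != j -> (forall x, 0 <= f x) ->
  (n%:R - 2) * \sum_(s | fix2 i j s) f (s k) <= (n.-2)`!%:R * \sum_x f x.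
Proof.
move=> ij ki kj f0; set X := \sum_(s | _) _.
have eqX q : q != i -> q != j -> \sum_(s | fix2 i j s) f (s q) = X.
  move=> qi qj; rewrite /X [RHS](reindex_inj (mulgI (tperm k q))).
  apply: eq_big => [s|s _]; last by rewrite permM tpermL.
  by rewrite /fix2 !permM !tpermD.
have h : \sum_(s | fix2 i j s) \sum_x f x = (n.-2)`!%:R * \sum_x f x.
  by rewrite -(card_fix2 R ij) mulr_suml; under [RHS]eq_bigr do rewrite mul1r.
rewrite -h.
have <- : \sum_(s | fix2 i j s) \sum_x f (s x) =
          \sum_(s | fix2 i j s) \sum_x f x.
  by apply: eq_bigr => s _; rewrite [RHS](reindex_inj (@perm_inj _ s)).
rewrite exchange_big /= (sum_off2 i j X) // lerDr.
by rewrite addr_ge0 // sumr_ge0.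
Qed.

(** Apart from the terms at [(i, j)] and [(j, i)], every term with distinct indices has an index
    different from [i] and [j]. Averaging over the image of that index replaces the entry of [Y] by
    at most [norm1 Y / (n - 2)]. *)
Lemma bil_fix2 (R : realFieldType) (n : nat) (X Y : 'M[R]_n) (i j : 'I_n) :
  (4 <= n)%N -> i != j -> (forall k, X k k = 0) ->
  (n%:R - 2) * \sum_(s | fix2 i j s)
     `|bil X Y s - (X i j * Y i j + X j i * Y j i)| <=
  (n.-2)`!%:R * (norm1 X * norm1 Y).
Proof.
move=> n4 ij Xd; have n4R : 4 <= n%:R :> R by rewrite ler_nat.
have n2 : 0 <= n%:R - 2 :> R by lra.
pose main := fun k l => ((k == i) && (l == j)) || ((k == j) && (l == i)).
have ji : j != i by rewrite eq_sym.
have split_bil s : fix2 i j s ->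
    bil X Y s - (X i j * Y i j + X j i * Y j i) =
    \sum_k \sum_l (if main k l then 0 else X k l * Y (s k) (s l)).
  move=> /andP[/eqP si /eqP sj]; rewrite /bil.
  have -> : \sum_k \sum_l (if main k l then 0 else X k l * Y (s k) (s l)) =
      \sum_k \sum_l X k l * Y (s k) (s l) -
      \sum_k \sum_l (if main k l then X k l * Y (s k) (s l) else 0).
    rewrite -sumrB; apply: eq_bigr => k _; rewrite -sumrB.
    by apply: eq_bigr => l _; case: ifP => _; rewrite ?subrr ?subr0.
  congr (_ - _); rewrite (sum_off2 i j 0) //; last first.
    move=> k ki kj; rewrite big1 // => l _.
    by rewrite /main (negbTE ki) (negbTE kj).
  rewrite mulr0 addr0; congr (_ + _).
    rewrite (bigD1 j) //= big1 => [|l lj].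
      by rewrite /main !eqxx /= addr0 si sj.
    by rewrite /main (negbTE lj) (negbTE ij) andbF.
  rewrite (bigD1 i) //= big1 => [|l li].
    by rewrite /main !eqxx /= orbT addr0 si sj.
  by rewrite /main (negbTE li) (negbTE ji) andbF.
have term k l : (n%:R - 2) * \sum_(s | fix2 i j s)
    `|if main k l then 0 else X k l * Y (s k) (s l)| <=
    `|X k l| * ((n.-2)`!%:R * norm1 Y).
  have rhs0 : 0 <= `|X k l| * ((n.-2)`!%:R * norm1 Y).
    by rewrite !mulr_ge0 ?norm1_ge0.
  case mkl: (main k l); first by rewrite normr0 big1 ?mulr0.
  have [<-|kl] := eqVneq k l.
    by rewrite Xd normr0 mul0r big1 ?mulr0 // => s _; rewrite mul0r normr0.
  under eq_bigr do rewrite normrM.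
  rewrite -mulr_sumr mulrCA ler_wpM2l //.
  have [/andP[ki kj]|kin] := boolP ((k != i) && (k != j)).
    apply: le_trans (sum_fix2_le (f := fun x => \sum_y `|Y x y|) ij ki kj _).
      rewrite ler_wpM2l // ler_sum // => s _.
      by rewrite (bigD1 (s l)) //= lerDl sumr_ge0.
    by move=> x; rewrite sumr_ge0.
  have [/andP[li lj]|lin] := boolP ((l != i) && (l != j)).
    rewrite /norm1 exchange_big.
    apply: le_trans (sum_fix2_le (f := fun y => \sum_x `|Y x y|) ij li lj _).
      rewrite ler_wpM2l // ler_sum // => s _.
      by rewrite (bigD1 (s k)) //= lerDl sumr_ge0.
    by move=> x; rewrite sumr_ge0.
  exfalso; move: kin lin mkl kl; rewrite !negb_and !negbK /main.
  by case/orP=> /eqP ->; case/orP=> /eqP ->; rewrite ?eqxx ?orbT.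
apply: (@le_trans _ _ (\sum_k \sum_l `|X k l| * ((n.-2)`!%:R * norm1 Y))).
  apply: (@le_trans _ _ (\sum_k \sum_l (n%:R - 2) * \sum_(s | fix2 i j s)
    `|if main k l then 0 else X k l * Y (s k) (s l)|)); last first.
    by apply: ler_sum => k _; apply: ler_sum => l _; exact: term.
  under [leRHS]eq_bigr do rewrite -mulr_sumr.
  rewrite -mulr_sumr ler_wpM2l //.
  under [leRHS]eq_bigr do rewrite exchange_big.
  rewrite exchange_big /= ler_sum // => s hs.
  rewrite (split_bil s hs) (le_trans (ler_norm_sum _ _ _)) // ler_sum // => k _.
  exact: ler_norm_sum.
under eq_bigr do rewrite -mulr_suml.
by rewrite -mulr_suml /norm1 mulrCA.
Qed.

(** A weight [th] equalizes two norms whose product is bounded: the two quantities [th * b] and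
    [e / th * a] have product [e * a * b], at most [16^-1 * 16^-1]. *)
Lemma balance (R : realFieldType) (L e a b : R) : 0 < e ->
  e * L <= 16^-1 * 16^-1 -> 0 <= a -> 0 <= b -> a * b <= L ->
  exists2 th, 0 < th & th * b <= 16^-1 /\ e / th * a <= 16^-1.
Proof.
move=> e0 eL a0 b0 ab; have ea : 0 <= e * a by rewrite mulr_ge0 // ltW.
(* If [b = 0], any sufficiently large [th] will do. *)
have [->|bn0] := eqVneq b 0.
  have h : 0 < 16 * (e * a) + 1 by rewrite ltr_wpDl // mulr_ge0.
  exists (16 * (e * a) + 1) => //; split; first by rewrite mulr0 invr_ge0.
  by rewrite mulrAC ler_pdivrMr //; lra.
have b1 : 0 < b by rewrite lt_def bn0.
exists (16 * b)^-1; first by rewrite invr_gt0 mulr_gt0.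
split; first by rewrite invfM divfK.
rewrite invrK; have : e * (a * b) <= 16^-1 * 16^-1.
  by apply: le_trans eL; rewrite ler_wpM2l // ltW.
by lra.
Qed.

(** Suppose every summand is below [e]. Where the absolute value of [X1 i j] is at least [t1], the
    summand is at most [e / t1] times that value, and likewise for [X2]; elsewhere each product is
    at most [t1] or [t2] times the entry of [Y1] or [Y2]. With the weights of [balance] the total
    would be at most [4 / 16], below [2^-1]. *)
Lemma heavy_pair (R : realFieldType) (n : nat) (X1 Y1 X2 Y2 : 'M[R]_n)
    (L e : R) :
  0 < e -> e * L <= 16^-1 * 16^-1 -> norm1 X1 * norm1 Y1 <= L -> norm1 X2 * norm1 Y2 <= L ->
  2^-1 <= \sum_i \sum_j (X1 i j * Y1 i j + X2 i j * Y2 i j) ->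
  exists i j, e <= X1 i j * Y1 i j + X2 i j * Y2 i j.
Proof.
move=> e0 eL h1 h2 hs; apply: contrapT => no.
have [t1 t10 [u1 v1]] := balance e0 eL (norm1_ge0 _) (norm1_ge0 _) h1.
have [t2 t20 [u2 v2]] := balance e0 eL (norm1_ge0 _) (norm1_ge0 _) h2.
have pt i j : X1 i j * Y1 i j + X2 i j * Y2 i j <=
    (e / t1 * `|X1 i j| + t1 * `|Y1 i j|) +
    (e / t2 * `|X2 i j| + t2 * `|Y2 i j|).
  have small : X1 i j * Y1 i j + X2 i j * Y2 i j <= e.
    by rewrite leNgt; apply/negP => h; apply: no; exists i, j; exact: ltW.
  have nn (t : R) (X Y : 'M[R]_n) : 0 < t ->
      0 <= e / t * `|X i j| /\ 0 <= t * `|Y i j|.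
    by move=> /ltW t0; split; rewrite !mulr_ge0 ?invr_ge0 ?(ltW e0).
  have [p1 q1] := nn t1 X1 Y1 t10; have [p2 q2] := nn t2 X2 Y2 t20.
  have big (t : R) (X : 'M[R]_n) : 0 < t -> t <= `|X i j| ->
      e <= e / t * `|X i j|.
    by move=> t0 tX; rewrite mulrAC ler_pdivlMr // ler_wpM2l // ltW.
  have low (t : R) (X Y : 'M[R]_n) : `|X i j| <= t ->
      X i j * Y i j <= t * `|Y i j|.
    by move=> h; rewrite (le_trans (ler_norm _)) // normrM ler_wpM2r.
  have [g1|/ltW g1] := leP t1 `|X1 i j|.
    by have := big _ _ t10 g1; lra.
  have [g2|/ltW g2] := leP t2 `|X2 i j|.
    by have := big _ _ t20 g2; lra.
  by have := low _ _ Y1 g1; have := low _ _ Y2 g2; lra.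
have : \sum_i \sum_j (X1 i j * Y1 i j + X2 i j * Y2 i j) <=
    (e / t1 * norm1 X1 + t1 * norm1 Y1) + (e / t2 * norm1 X2 + t2 * norm1 Y2).
  rewrite /norm1 !mulr_sumr -!big_split /= ler_sum // => i _.
  by rewrite !mulr_sumr -!big_split /= ler_sum.
by lra.
Qed.

(* The permutations fixing a heavy pair already make up a proportion
   (1 - o(1)) / n^2 of good ones. *)
Lemma heavy_pair_count (R : realFieldType) (n : nat) (X1 Y1 X2 Y2 : 'M[R]_n)
    (L e kappa th : R) (F : 'S_n -> R) :
  (4 <= n)%N -> 0 < e -> e * L <= 16^-1 * 16^-1 ->
  norm1 X1 * norm1 Y1 <= L -> norm1 X2 * norm1 Y2 <= L ->
  (forall k, X1 k k = 0) -> (forall k, X2 k k = 0) ->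
  (forall i j, X1 j i * Y1 j i = X1 i j * Y1 i j) ->
  (forall i j, X2 j i * Y2 j i = X2 i j * Y2 i j) ->
  2^-1 <= bil X1 Y1 1%g + bil X2 Y2 1%g ->
  (forall s, bil X1 Y1 s + bil X2 Y2 s - kappa <= F s) ->
  kappa <= e / 2 -> th <= e / 2 ->
  (n.-2)`!%:R * (1 - 2 * L / (e * (n%:R - 2))) <= #|[set s | th <= F s]|%:R.
Proof.
move=> n4 e0 eL h1 h2 d1 d2 s1 s2 one hF kap thr.
have n4R : 4 <= n%:R :> R by rewrite ler_nat.
have n2 : 0 < n%:R - 2 :> R by lra.
have one' : 2^-1 <= \sum_i \sum_j (X1 i j * Y1 i j + X2 i j * Y2 i j).
  apply: le_trans one _; rewrite /bil -big_split /= ler_sum // => i _.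
  by rewrite -big_split /= ler_sum // => j _; rewrite !perm1.
have [i [j hij]] := heavy_pair e0 eL h1 h2 one'.
have ij : i != j by apply: contraTneq hij => ->; rewrite d1 d2 !mul0r addr0 leNgt e0.
pose dev s := `|bil X1 Y1 s - (X1 i j * Y1 i j + X1 j i * Y1 j i)| +
              `|bil X2 Y2 s - (X2 i j * Y2 i j + X2 j i * Y2 j i)|.
have devS : (n%:R - 2) * \sum_(s | fix2 i j s) dev s <=
    (n.-2)`!%:R * (2 * L).
  rewrite big_split mulrDr /=.
  have k1 := bil_fix2 Y1 n4 ij d1; have k2 := bil_fix2 Y2 n4 ij d2.
  rewrite (le_trans (lerD k1 k2)) // -mulrDr ler_wpM2l //.
  by lra.
(* Markov's inequality: the pairs [(i, j)] and [(j, i)] contribute at least [2 * e] while [kappa]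
   and [th] take at most [e / 2] each, so a bad permutation has [dev s >= e]. *)
have pt s : fix2 i j s -> 1 - dev s / e <= (th <= F s)%R%:R.
  move=> _; case: (leP th (F s)) => [_|bad].
    by rewrite gerBl divr_ge0 // ?(ltW e0) // addr_ge0.
  rewrite subr_le0 ler_pdivlMr // mul1r.
  have := hF s.
  have := ler_norm (- (bil X1 Y1 s - (X1 i j * Y1 i j + X1 j i * Y1 j i))).
  have := ler_norm (- (bil X2 Y2 s - (X2 i j * Y2 i j + X2 j i * Y2 j i))).
  by rewrite /dev !normrN (s1 i j) (s2 i j); lra.
have card : \sum_(s | fix2 i j s) (th <= F s)%R%:R <=
    #|[set s | th <= F s]|%:R :> R.
  rewrite -sum1_card natr_sum [leRHS]big_mkcond [leLHS]big_mkcond /=.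
  apply: ler_sum => s _; rewrite finset.in_set; case: ifP => _; first by case: ifP.
  by case: ifP.
apply: le_trans card; apply: le_trans (ler_sum _ pt).
rewrite sumrB card_fix2 // mulrBr mulr1 lerD2l lerN2.
rewrite -mulr_suml ler_pdivrMr // -(ler_pM2l n2) (le_trans devS) //.
rewrite le_eqVlt; apply/orP; left; apply/eqP; field.
by rewrite !gt_eqF.
Qed.

(** * Counting good permutations for part (1) *)

Lemma sum_bil (R : realFieldType) (n : nat) (A B : 'M[R]_n) :
  zero_sum A -> zero_sum B -> \sum_(s : 'S_n) bil A B s = 0.
Proof.
move=> [_ _ Ad] [Br _ Bd].
rewrite /bil exchange_big big1 //= => i _; rewrite exchange_big big1 //= => j _.
rewrite -mulr_sumr; have [<-|ij] := eqVneq i j; first by rewrite Ad mul0r.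
rewrite (sum_perm_pair (fun k l => B k l) ij) big1 ?mulr0 // => k _.
by have := Br k; rewrite (bigD1 k) //= Bd add0r.
Qed.

Lemma factR_pred2 (R : realFieldType) (n : nat) : (2 <= n)%N ->
  n`!%:R = n%:R * (n%:R - 1) * (n.-2)`!%:R :> R.
Proof.
case: n => [|[|n]] // _; rewrite !factS !natrM /= mulrA.
by rewrite -[n.+2%:R]natr1 addrK.
Qed.

Lemma bil_parts_neg (R : realFieldType) (n : nat) (b : bool) (A B : 'M[R]_n)
    (s : 'S_n) :
  bil A B s = bil (part b A) (part b B) s + bil (part (~~ b) A) (part (~~ b) B) s.
Proof. by rewrite bil_parts; case: b; rewrite // addrC. Qed.

Lemma part_prod_tr (R : realFieldType) (n : nat) (b : bool) (A B : 'M[R]_n)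
    (i j : 'I_n) :
  part b A j i * part b B j i = part b A i j * part b B i j.
Proof. by rewrite part_tr [part b B j i]part_tr mulrACA -expr2 sqrr_sign mul1r. Qed.

Lemma bil0 (R : realFieldType) (n : nat) (s : 'S_n) : bil (0 : 'M[R]_n) 0 s = 0.
Proof.
by rewrite /bil big1 // => i _; rewrite big1 // => j _; rewrite !mxE mul0r.
Qed.

(** Since [bil A B] has mean zero, the sum of absolute values is twice the sum of positive parts,
    each at most 1 if the threshold is passed and at most [th] otherwise. *)
Lemma sum_norm_bil_le (R : realFieldType) (n : nat) (A B : 'M[R]_n) (th : R) :
  zero_sum A -> zero_sum B -> 0 <= th -> (forall s, bil A B s <= 1) ->
  \sum_(s : 'S_n) `|bil A B s| <=
  2 * (#|[set s | th <= bil A B s]|%:R + n`!%:R * th).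
Proof.
move=> Az Bz th0 F1.
have -> : 2 * (#|[set s | th <= bil A B s]|%:R + n`!%:R * th) =
    \sum_(s : 'S_n) (2 * ((th <= bil A B s)%R%:R + th) - bil A B s).
  rewrite sumrB sum_bil // subr0 -mulr_sumr big_split /= sumr_const card_Sn.
  congr (_ * (_ + _)); last by rewrite mulr_natl.
  rewrite -sum1_card natr_sum big_mkcond; apply: eq_bigr => s _.
  by rewrite finset.in_set; case: ifP.
apply: ler_sum => s _; have := F1 s.
case: (ger0P (bil A B s)) => h; case: (leP th (bil A B s)) => /= h'; lra.
Qed.

Lemma good_count (R : realType) (alpha delta : R) :
  0 <= alpha -> 0 <= delta -> delta < 1 -> exists N : nat,
  forall (n : nat) (A B : 'M[R]_n), (4 <= n)%N -> (N <= n)%N ->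
  zero_sum A -> zero_sum B -> (forall s, bil A B s <= 1) ->
  bil A B 1%g = 1 ->
  delta * n%:R ^- 2 <= #|[set s | alpha / n%:R ^+ 2 <= bil A B s]|%:R / n`!%:R.
Proof.
(* [K] comes from [sum_norm_bil_le] with at most [(n.-2)!] good permutations and with [n! * th] at
   most [alpha * (n.-2)!]. *)
move=> a0 d0 d1; pose K := 2 * (1 + alpha).
have K0 : 0 <= K by rewrite mulr_ge0 // addr_ge0.
have q0 : 0 < 4^-1 :> R by rewrite invr_gt0.
have [L0 L00 [N0 D0]] := bil_dichotomy K0 q0.
have [eps [eps0 epsL]] : exists eps : R -> R, (forall L, 0 < L -> 0 < eps L) /\
    (forall L, 0 < L -> eps L * L <= 16^-1 * 16^-1).
  exists (fun L => 16^-1 * 16^-1 / L); split=> L l0.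
    by rewrite divr_gt0 // mulr_gt0 // invr_gt0.
  by rewrite divfK // gt_eqF.
(* The dichotomy is used at two scales: a part below [kap] must not spoil a heavy pair of the other
   part, whose weight [eps L0] depends on the first constant [L0]. *)
pose kap := Num.min (eps L0 / 2) 4^-1.
have kap0 : 0 < kap by rewrite lt_min q0 divr_gt0 ?eps0.
have [L1 L10 [N1 D1]] := bil_dichotomy K0 kap0.
(* Beyond [bnd L], the proportion lost in [heavy_pair_count] is at most [1 - delta] and the
   threshold is at most [eps L / 2]. *)
pose bnd (L : R) := 2 * L / (eps L * (1 - delta)) + 2 * alpha / eps L + 2.
have dd : 0 < 1 - delta by lra.
exists (maxn (maxn N0 N1) (maxn (Num.truncn (bnd L0)).+1 (Num.truncn (bnd L1)).+1)).
move=> n A B n4; rewrite !geq_max => /andP[/andP[nN0 nN1] /andP[nb0 nb1]].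
move=> Az Bz F1 one.
have n4R : 4 <= n%:R :> R by rewrite ler_nat.
have n2 : 0 < n%:R - 2 :> R by lra.
have nbnd L : ((Num.truncn (bnd L)).+1 <= n)%N -> bnd L < n%:R.
  by move=> h; apply: lt_le_trans (truncnS_gt _) _; rewrite ler_nat.
set th := alpha / n%:R ^+ 2.
have nsq : 0 < n%:R ^+ 2 :> R by rewrite exprn_gt0 //; lra.
have th0 : 0 <= th by rewrite divr_ge0 // ltW.
have c20 : 0 < (n.-2)`!%:R :> R by rewrite ltr0n fact_gt0.
have fn := factR_pred2 R (ltnW (ltnW n4)).
have f0 : 0 < n`!%:R :> R by rewrite ltr0n fact_gt0.
have fc : n`!%:R <= n%:R ^+ 2 * (n.-2)`!%:R :> R.
  rewrite fn ler_pM2r // expr2 ler_wpM2l //; lra.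
have conclude L : 0 < L -> bnd L < n%:R ->
    (n.-2)`!%:R * (1 - 2 * L / (eps L * (n%:R - 2))) <=
      #|[set s | th <= bil A B s]|%:R ->
    delta * n%:R ^- 2 <= #|[set s | th <= bil A B s]|%:R / n`!%:R.
  move=> l0 nb h; have e0 := eps0 L l0.
  have h1 : 2 * L / (eps L * (n%:R - 2)) <= 1 - delta.
    have : 2 * L / (eps L * (1 - delta)) <= n%:R - 2.
      have : 0 <= 2 * alpha / eps L by rewrite !mulr_ge0 // invr_ge0 ltW.
      by move: nb; rewrite /bnd; lra.
    rewrite !ler_pdivrMr ?mulr_gt0 // => h0; apply: le_trans h0 _.
    by rewrite le_eqVlt; apply/orP; left; apply/eqP; ring.
  rewrite ler_pdivlMr // mulrAC ler_pdivrMr //.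
  apply: (@le_trans _ _ (delta * (n%:R ^+ 2 * (n.-2)`!%:R))).
    by rewrite ler_wpM2l.
  rewrite mulrCA [leRHS]mulrC ler_wpM2l ?(ltW nsq) // (le_trans _ h) //.
  by rewrite mulrC ler_wpM2l // ?(ltW c20) //; lra.
have thr L : 0 < L -> bnd L < n%:R -> th <= eps L / 2.
  move=> l0 nb; have e0 := eps0 L l0.
  apply: (@le_trans _ _ (alpha / n%:R)).
    rewrite ler_wpM2l // lef_pV2 ?posrE //; last by lra.
    by rewrite expr2 ler_peMl //; lra.
  have : 2 * alpha / eps L <= n%:R.
    have : 0 <= 2 * L / (eps L * (1 - delta)).
      by rewrite divr_ge0 ?mulr_ge0 // ltW // mulr_gt0.
    by move: nb; rewrite /bnd; lra.
  rewrite ler_pdivrMr // => h; rewrite ler_pdivrMr; last by lra.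
  by lra.
rewrite leNgt; apply/negP => bad.
have FK : \sum_(s : 'S_n) `|bil A B s| <= K * (n.-2)`!%:R.
  apply: le_trans (sum_norm_bil_le Az Bz th0 F1) _.
  rewrite /K -mulrA ler_wpM2l // mulrDl mul1r lerD //.
    move: bad; rewrite ltr_pdivrMr // => /ltW bad; apply: le_trans bad _.
    rewrite mulrAC ler_pdivrMr // [leRHS]mulrC.
    by apply: le_trans fc; rewrite ler_piMl ?ltW.
  by rewrite /th mulrCA ler_wpM2l // ler_pdivrMr // mulrC.
have diag0 b k : part b A k k = 0 by have [_ _ ->] := zero_sum_part b Az.
(* If one part is uniformly small, the other is at least [3 / 4] at the identity, so it is not small
   at scale [4^-1] and has bounded mass. Its heavy pair suffices, the small part being absorbed in
   [kappa]. *)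
have low b : (forall s, `|bil (part b A) (part b B) s| <= kap) -> False.
  move=> small; have kq : kap <= 4^-1 by rewrite ge_min lexx orbT.
  have main : 1 - kap <= bil (part (~~ b) A) (part (~~ b) B) 1%g.
    have := small 1%g; have := ler_norm (bil (part b A) (part b B) 1%g).
    by move: one; rewrite (bil_parts_neg b); lra.
  case: (D0 n (~~ b) A B n4 nN0 Az Bz FK) => [sm|norms].
    by have := sm 1%g; have := ler_norm (bil (part (~~ b) A) (part (~~ b) B) 1%g); lra.
  move: bad; apply/negP; rewrite -leNgt; apply: (conclude L0) => //.
    exact: nbnd.
  apply: (heavy_pair_count (X1 := part (~~ b) A) (Y1 := part (~~ b) B) (X2 := 0) (Y2 := 0)
    (kappa := kap)) => //.
  - exact: eps0.
  - exact: epsL.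
  - rewrite (_ : norm1 0 = 0) ?mul0r ?(ltW L00) // /norm1 big1 // => i _.
    by rewrite big1 // => j _; rewrite mxE normr0.
  - by move=> k; rewrite mxE.
  - by move=> i j; exact: part_prod_tr.
  - by move=> i j; rewrite !mxE.
  - by rewrite bil0 addr0; lra.
  - move=> s; rewrite bil0 addr0 [in leRHS](bil_parts_neg b).
    have := small s; have := ler_norm (- bil (part b A) (part b B) s).
    by rewrite normrN; lra.
  - by rewrite ge_min lexx.
  - by apply: thr => //; exact: nbnd.
(* In the remaining case both parts have bounded mass. *)
case: (D1 n false A B n4 nN1 Az Bz FK) => [/low //|m0].
case: (D1 n true A B n4 nN1 Az Bz FK) => [/low //|m1].
move: bad; apply/negP; rewrite -leNgt; apply: (conclude L1) => //.
  exact: nbnd.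
apply: (heavy_pair_count (X1 := part false A) (Y1 := part false B)
  (X2 := part true A) (Y2 := part true B) (kappa := 0)) => //.
- exact: eps0.
- exact: epsL.
- by move=> i j; exact: part_prod_tr.
- by move=> i j; exact: part_prod_tr.
- by rewrite -bil_parts one; lra.
- by move=> s; rewrite -bil_parts subr0.
- by rewrite divr_ge0 // ltW // eps0.
- by apply: thr => //; exact: nbnd.
Qed.

(** * Class averages *)

Lemma bil_conj (R : realFieldType) (n : nat) (A B : 'M[R]_n) (s r : 'S_n) :
  bil A B (s ^ r)%g =
  \sum_p \sum_q A (r p) (r q) * B (r (s p)) (r (s q)).
Proof.
rewrite /bil (reindex_inj (@perm_inj _ r)); apply: eq_bigr => p _.
rewrite (reindex_inj (@perm_inj _ r)); apply: eq_bigr => q _.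
by rewrite !permJ.
Qed.

(** Correlations under a uniform relabelling [r]: summing [bil] over the conjugates [s ^ r] adds up
    the entries at [(s p, s q)] over all [p] and [q]. *)
Definition corr_mx (R : realFieldType) (n : nat) (A B : 'M[R]_n)
    (p q : 'I_n) : 'M[R]_n :=
  \matrix_(x, y) \sum_(r : 'S_n) A (r p) (r q) * B (r x) (r y).

Lemma corr_mx_zero_sum (R : realFieldType) (n : nat) (A B : 'M[R]_n)
    (p q : 'I_n) : zero_sum B -> zero_sum (corr_mx A B p q).
Proof.
case=> Br Bc Bd; split=> [x|y|x].
- under eq_bigr do rewrite mxE.
  rewrite exchange_big big1 //= => r _; rewrite -mulr_sumr.
  have -> : \sum_y B (r x) (r y) = \sum_y B (r x) y.
    by rewrite [RHS](reindex_inj (@perm_inj _ r)).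
  by rewrite Br mulr0.
- under eq_bigr do rewrite mxE.
  rewrite exchange_big big1 //= => r _; rewrite -mulr_sumr.
  have -> : \sum_x B (r x) (r y) = \sum_x B x (r y).
    by rewrite [RHS](reindex_inj (@perm_inj _ r)).
  by rewrite Bc mulr0.
- by rewrite mxE big1 // => r _; rewrite Bd mulr0.
Qed.

Lemma corr_mx_inv (R : realFieldType) (n : nat) (A B : 'M[R]_n)
    (p q : 'I_n) : stab_inv (corr_mx A B p q) p q.
Proof.
move=> g gp gq x y; rewrite !mxE [RHS](reindex_inj (mulgI g)).
by apply: eq_bigr => r _; rewrite !permM gp gq.
Qed.

Lemma corr_mx_pq (R : realFieldType) (n : nat) (A B : 'M[R]_n)
    (p q : 'I_n) : p != q -> zero_sum A ->
  corr_mx A B p q p q = (n.-2)`!%:R * \sum_i \sum_j A i j * B i j /\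
  corr_mx A B p q q p = (n.-2)`!%:R * \sum_i \sum_j A i j * B j i.
Proof.
move=> pq [_ _ Ad]; rewrite !mxE.
rewrite (sum_perm_pair (fun i j => A i j * B i j) pq).
rewrite (sum_perm_pair (fun i j => A i j * B j i) pq).
by rewrite !sum_offdiag // => i; rewrite Ad mul0r.
Qed.

Lemma card_fixed (R : realFieldType) (n : nat) (s : 'S_n) :
  \sum_p (s p == p)%:R = #|[set p | s p == p]|%:R :> R.
Proof.
rewrite -sum1_card natr_sum [RHS]big_mkcond; apply: eq_bigr => p _.
by rewrite finset.in_set; case: ifP.
Qed.

(* The coefficient of [\sum A i j * B j i] in the class average is governed by
   the number of 2-cycles of [s], so its sign can be chosen. *)
Lemma class_sum_ge (R : realFieldType) (n : nat) (A B : 'M[R]_n) (s : 'S_n)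
    (f : nat) :
  let G := \sum_i \sum_j A i j * B j i in
  (4 <= n)%N -> zero_sum A -> zero_sum B -> 0 <= bil A B 1%g ->
  #|[set p | s p == p]| = f -> (3 <= f)%N ->
  (0 <= G /\ exists a b, [/\ a != b, s a = b & s b = a]) \/
  (G <= 0 /\ forall a, s (s a) = a -> s a = a) ->
  (n.-2)`!%:R * bil A B 1%g * (f%:R * (f%:R - 3)) <=
  \sum_(r : 'S_n) bil A B (s ^ r)%g.
Proof.
move=> G n4 Az Bz one cf f3 alt.
have n4R : 4 <= n%:R :> R by rewrite ler_nat.
have n2 : n%:R - 2 != 0 :> R by apply/eqP; lra.
have n3 : n%:R - 3 != 0 :> R by apply/eqP; lra.
have c20 : 0 <= (n.-2)`!%:R :> R by [].
set u := (n.-2)`!%:R * bil A B 1%g.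
have u0 : 0 <= u by rewrite mulr_ge0.
pose u' := (n.-2)`!%:R * G.
pose a : R := (n%:R - 2)^-1; pose w : R := ((n%:R - 2) * (n%:R - 3))^-1.
have a0 : 0 <= a by rewrite invr_ge0; lra.
have w0 : 0 <= w by rewrite invr_ge0 mulr_ge0; lra.
have uw : 0 <= u * w by rewrite mulr_ge0.
pose W p q := corr_mx A B p q (s p) (s q).
have -> : \sum_(r : 'S_n) bil A B (s ^ r)%g = \sum_p \sum_q W p q.
  under eq_bigr do rewrite bil_conj.
  rewrite exchange_big; apply: eq_bigr => p _ /=.
  by rewrite exchange_big; apply: eq_bigr => q _; rewrite /W mxE.
have W0 p : W p p = 0.
  by rewrite /W; have [_ _ ->] := corr_mx_zero_sum A p p Bz.
(* [e] is the permutation matrix of [s]; for distinct [p] and [q], [l1] is the coefficient of [u] in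
   [W p q] that comes from pairs with a fixed point. *)
pose e p q : R := (s p == q)%:R.
pose l1 p q := e p p * e q q -
  (e p p * (1 - e q q) + (1 - e p p) * e q q) * a.
have ent p q : p != q -> let V := corr_mx A B p q in
    [/\ V p q = u, V q p = u' &
     forall x, x != p -> x != q ->
     [/\ V p x = - u * a, V x q = - u * a, V q x = - u' * a,
         V x p = - u' * a
       & forall y, y != p -> y != q -> y != x -> V y x = (u + u') * w]].
  move=> pq /=; have [e1 e2] := corr_mx_pq B pq Az.
  have e1' : corr_mx A B p q p q = u.
    rewrite e1 /u /bil; congr (_ * _); apply: eq_bigr => i _.
    by apply: eq_bigr => j _; rewrite !perm1.
  split=> // x xp xq; have := stab_inv_entries n4 pq
    (corr_mx_zero_sum A p q Bz) (@corr_mx_inv _ _ A B p q) xp xq.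
  by rewrite e1' e2.
have sinj p q : p != q -> s p != s q by rewrite (inj_eq perm_inj).
have ef : \sum_p e p p = f%:R by rewrite card_fixed cf.
have erow p : \sum_q e p q = 1.
  by rewrite (bigD1 (s p)) //= /e eqxx big1 ?addr0 // => q /negbTE; rewrite eq_sym => ->.
have ecol q : \sum_p e p q = 1.
  rewrite (bigD1 (s^-1%g q)) //= /e permKV eqxx big1 ?addr0 // => p pq.
  by rewrite -[q](permKV s) (inj_eq perm_inj) (negbTE pq).
have fn : f%:R <= n%:R :> R.
  by rewrite ler_nat -cf -[X in (_ <= X)%N](card_ord n) max_card.
have f3R : 3 <= f%:R :> R by rewrite ler_nat.
have n2a : (n%:R - 2) * a = 1 by rewrite mulfV.
have n3w : (n%:R - 3) * w = a by rewrite /w /a; field; apply/andP.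
have sum1 : \sum_p \sum_q l1 p q - \sum_p e p p =
    f%:R * f%:R - 2 * f%:R * (n%:R - f%:R) * a - f%:R.
  rewrite ef; congr (_ - _).
  have row p : \sum_q l1 p q =
      e p p * f%:R - (e p p * (n%:R - f%:R) + (1 - e p p) * f%:R) * a.
    rewrite /l1 sumrB -mulr_sumr -mulr_suml big_split /= -!mulr_sumr sumrB ef.
    by rewrite sumr_const card_ord.
  under eq_bigr do rewrite row.
  rewrite sumrB -mulr_suml -mulr_suml big_split /= -!mulr_suml sumrB ef.
  by rewrite sumr_const card_ord; ring.
(* The [u] part alone gives [f * (f - 3)]: the diagonal costs [f], and the pairs with one fixed
   point at most [2 * f] because [(n - f) * a <= 1]. It remains to make the [u'] part
   nonnegative. *)
have final S : 0 <= u' * S ->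
    \sum_p \sum_q l1 p q * u - \sum_p e p p * u + u' * S <= \sum_p \sum_q W p q ->
    u * (f%:R * (f%:R - 3)) <= \sum_p \sum_q W p q.
  move=> h0 h; apply: le_trans h.
  under eq_bigr do rewrite -mulr_suml.
  rewrite -!mulr_suml -mulrBl sum1 mulrC -[leLHS]addr0 lerD // ler_wpM2r //.
  have : 2 * f%:R * ((n%:R - f%:R) * a) <= 2 * f%:R * 1.
    rewrite ler_wpM2l ?mulr_ge0 // -[leRHS]n2a ler_wpM2r //; lra.
  by lra.
(* [N] indicates that [s] maps both [p] and [q] outside the pair. *)
pose N p q := (1 - e p p) * (1 - e q q) * (1 - e p q) * (1 - e q p).
have e01 p q : 0 <= e p q <= 1 by rewrite /e; case: (_ == _); rewrite ?lexx ?ler01.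
have N0 p q : 0 <= N p q.
  have h x y : 0 <= 1 - e x y by have := e01 x y; lra.
  by rewrite /N !mulr_ge0.
have val p q : p != q -> W p q = (l1 p q + N p q * w) * u +
    (e p q * e q p - (e p q * (1 - e q p) + (1 - e p q) * e q p) * a
     + N p q * w) * u'.
  move=> pq; have [Vpq Vqp oth] := ent p q pq.
  have sxy := sinj p q pq; rewrite /W /N /l1 /e.
  have [xp|xp] := eqVneq (s p) p; have [xq|xq] := eqVneq (s p) q;
  have [yq|yq] := eqVneq (s q) q; have [yp|yp] := eqVneq (s q) p;
    try (by case/eqP: pq; congruence); try (by case/eqP: sxy; congruence).
  - by rewrite xp yq Vpq /=; ring.
  - by rewrite xp; have [-> _ _ _ _] := oth _ yp yq; rewrite /=; ring.
  - by rewrite xq yp Vqp /=; ring.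
  - by rewrite xq; have [_ _ -> _ _] := oth _ yp yq; rewrite /=; ring.
  - by rewrite yq; have [_ -> _ _ _] := oth _ xp xq; rewrite /=; ring.
  - by rewrite yp; have [_ _ _ -> _] := oth _ xp xq; rewrite /=; ring.
  - by have [_ _ _ _ ->] := oth _ yp yq; rewrite //=; ring.
(* Sums over all pairs are easier to evaluate; the formula's values on the diagonal, where [W]
   vanishes, are then subtracted. *)
have diag (c : 'I_n -> R) (g : 'I_n -> 'I_n -> R) :
    (forall p q, p != q -> g p q <= W p q) -> (forall p, g p p = c p) ->
    \sum_p \sum_q g p q - \sum_p c p <= \sum_p \sum_q W p q.
  move=> gW gc; rewrite -sumrB; apply: ler_sum => p _.
  rewrite (bigD1 p) //= gc addrAC subrr add0r [leRHS](bigD1 p) //= W0 add0r.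
  by apply: ler_sum => q qp; apply: gW; rewrite eq_sym.
have l1pp p : l1 p p = e p p by rewrite /l1 /e; case: (_ == _) => /=; ring.
have sume : \sum_p \sum_q e p q = n%:R.
  under eq_bigr do rewrite erow.
  by rewrite sumr_const card_ord.
have sume' : \sum_p \sum_q e q p = n%:R by rewrite exchange_big.
have comb (g : 'I_n -> 'I_n -> R) (c : 'I_n -> R) :
    \sum_p \sum_q (l1 p q * u + g p q * u') - \sum_p (e p p * u + c p * u') =
    \sum_p \sum_q l1 p q * u - \sum_p e p p * u +
    u' * (\sum_p \sum_q g p q - \sum_p c p).
  under eq_bigr do rewrite big_split /=.
  rewrite !big_split /= -!mulr_suml.
  under [X in _ + X - _]eq_bigr do rewrite -mulr_suml.
  by rewrite -mulr_suml; ring.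
case: alt => -[G0 cyc].
- have u'0 : 0 <= u' by rewrite mulr_ge0.
  have u'w : 0 <= u' * w by rewrite mulr_ge0.
  pose l2 p q := e p q * e q p -
    (e p q * (1 - e q p) + (1 - e p q) * e q p) * a.
  (* [T] counts the points with [s (s p) = p]; a 2-cycle gives [T >= f + 2], which makes the
     coefficient of [u'] nonnegative. *)
  pose T := \sum_p \sum_q e p q * e q p.
  apply: (final (\sum_p \sum_q l2 p q - \sum_p e p p)).
    rewrite mulr_ge0 // ef.
    have -> : \sum_p \sum_q l2 p q = T - (2 * n%:R - 2 * T) * a.
      have -> : \sum_p \sum_q l2 p q = \sum_p \sum_q e p q * e q p -
          (\sum_p \sum_q e p q + \sum_p \sum_q e q p
           - 2 * \sum_p \sum_q e p q * e q p) * a.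
        rewrite mulr_sumr -big_split -sumrB mulr_suml -sumrB /=.
        apply: eq_bigr => p _.
        rewrite mulr_sumr -big_split -sumrB mulr_suml -sumrB /=.
        by apply: eq_bigr => q _; rewrite /l2; ring.
      by rewrite sume sume' -/T; ring.
    have T2 : f%:R + 2 <= T.
      have [i [j [ij si sj]]] := cyc.
      have row p : \sum_q e p q * e q p = e (s p) p.
        rewrite (bigD1 (s p)) //= {1}/e eqxx mul1r big1 ?addr0 // => q.
        by rewrite eq_sym /e => /negbTE ->; rewrite mul0r.
      have delta k : \sum_(p : 'I_n) (p == k)%:R = 1 :> R.
        by rewrite (bigD1 k) //= eqxx big1 ?addr0 // => p /negbTE ->.
      have -> : f%:R + 2 = \sum_p e p p + (\sum_p (p == i)%:R +
          \sum_p (p == j)%:R) :> R by rewrite ef !delta.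
      rewrite -!big_split /=.
      apply: ler_sum => p _; rewrite row /e.
      have [->|pi] := eqVneq p i.
        by rewrite si sj eqxx (negbTE ij) eq_sym (negbTE ij) !add0r addr0.
      have [->|pj] := eqVneq p j.
        by rewrite sj si eqxx (negbTE ij) !add0r.
      rewrite !addr0; have [sp|_] := eqVneq (s p) p; last exact: ler0n.
      by rewrite !sp eqxx.
    have : 2 * ((n%:R - f%:R - 2) * a) <= 2 * 1.
      rewrite ler_wpM2l // -[leRHS]n2a ler_wpM2r //; lra.
    have : 0 <= (T - f%:R - 2) * a by rewrite mulr_ge0 //; lra.
    by lra.
  have := @diag (fun p => e p p * u + e p p * u')
    (fun p q => l1 p q * u + l2 p q * u').
  rewrite comb.
  apply=> [p q pq|p].
    rewrite (val p q pq) /l2.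
    have : 0 <= N p q * (u * w + u' * w) by rewrite mulr_ge0 // addr_ge0.
    by lra.
  by rewrite l1pp /l2 /e; case: (_ == _) => /=; ring.
have u'0 : u' <= 0 by rewrite mulr_ge0_le0.
(* Now the coefficient of [u'] has to be at most 0: the 2-cycle term vanishes, and [N] is replaced
   by a larger product whose sum is explicit. *)
pose l2 p q := (1 - e p p) * (1 - e q q) * w - (e p q + e q p) * a.
pose l2d p := (1 - e p p) * w - 2 * e p p * a.
have sumd : \sum_p l2d p = (n%:R - f%:R) * w - 2 * f%:R * a.
  rewrite sumrB -!mulr_suml -mulr_sumr sumrB ef.
  by rewrite sumr_const card_ord.
apply: (final (\sum_p \sum_q l2 p q - \sum_p l2d p)).
  rewrite mulr_le0 // sumd.
  have -> : \sum_p \sum_q l2 p q = (n%:R - f%:R) ^+ 2 * w - 2 * n%:R * a.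
    have row p : \sum_q l2 p q =
        (1 - e p p) * ((n%:R - f%:R) * w) - (1 + \sum_q e q p) * a.
      rewrite sumrB -!mulr_suml -mulr_sumr sumrB big_split /= erow ef.
      by rewrite sumr_const card_ord mulrA.
    under eq_bigr do rewrite row ecol.
    rewrite sumrB -!mulr_suml sumrB ef !sumr_const card_ord.
    by rewrite -mulr_natl; ring.
  have : 0 <= (n%:R - f%:R) * ((n%:R - 3) * w - (n%:R - f%:R - 1) * w).
    by rewrite mulr_ge0 ?subr_ge0 // ler_wpM2r //; lra.
  have : 0 <= (n%:R - f%:R) * a by rewrite mulr_ge0 // subr_ge0.
  by rewrite n3w; lra.
have := @diag (fun p => e p p * u + l2d p * u')
  (fun p q => l1 p q * u + l2 p q * u').
rewrite comb.
apply=> [p q pq|p]; last first.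
  by rewrite l1pp /l2 /l2d /e; case: (_ == _) => /=; ring.
have no2 : e p q * e q p = 0.
  rewrite /e; have [spq|_] := eqVneq (s p) q; last by rewrite mul0r.
  have [sqp|_] := eqVneq (s q) p; last by rewrite mulr0.
  by case/eqP: pq; rewrite -spq cyc // spq sqp.
rewrite (val p q pq) /l2.
have NM : N p q <= (1 - e p p) * (1 - e q q).
  have h x y : 0 <= 1 - e x y <= 1 by have := e01 x y; lra.
  rewrite /N -mulrA ler_piMr //; last first.
    by rewrite mulr_ile1 //; have := h p q; have := h q p; lra.
  by rewrite mulr_ge0 //; [have := h p p | have := h q q]; lra.
have : 0 <= N p q * (u * w) by rewrite mulr_ge0.
have : 0 <= ((1 - e p p) * (1 - e q q) - N p q) * (w * - u').
  by rewrite mulr_ge0 ?subr_ge0 // mulr_ge0 // oppr_ge0.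
have -> : e p q * e q p - (e p q * (1 - e q p) + (1 - e p q) * e q p) * a
    + N p q * w = (1 + 2 * a) * (e p q * e q p) - (e p q + e q p) * a
    + N p q * w by ring.
by rewrite no2; lra.
Qed.

(** * Permutations of prescribed cycle type *)

Definition cyc_fun (n f : nat) (d : bool) (i : nat) : nat :=
  if (i < f)%N then i
  else if d && (i == f) then f.+1
  else if d && (i == f.+1) then f
  else if (i.+1 < n)%N then i.+1 else (if d then f.+2 else f).

Lemma cyc_fun_lt (n f : nat) (d : bool) (i : nat) :
  (f + 4 <= n)%N -> (i < n)%N -> (cyc_fun n f d i < n)%N.
Proof. by rewrite /cyc_fun; case: d => /=; do ?case: ifP; lia. Qed.

Lemma cyc_fun_inj (n f : nat) (d : bool) (i j : nat) : (f + 4 <= n)%N ->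
  (i < n)%N -> (j < n)%N -> cyc_fun n f d i = cyc_fun n f d j -> i = j.
Proof.
rewrite /cyc_fun; case: d => /=; do ?case: ifP; lia.
Qed.

Lemma cyc_perm (n f : nat) (d : bool) : (f + 4 <= n)%N ->
  exists s : 'S_n, forall i, s i = cyc_fun n f d i :> nat.
Proof.
move=> fn; pose c (i : 'I_n) := Ordinal (cyc_fun_lt d fn (ltn_ord i)).
have ci : injective c.
  by move=> i j [] /(cyc_fun_inj fn (ltn_ord i) (ltn_ord j)) /val_inj.
by exists (perm ci) => i; rewrite permE.
Qed.

Lemma card_ord_lt (n f : nat) : (f <= n)%N -> #|[set i : 'I_n | (i < f)%N]| = f.
Proof.
move=> fn; have wi : injective (widen_ord fn).
  by move=> i j /(congr1 val) /= /val_inj.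
rewrite -[RHS](card_ord f) -(card_imset _ wi).
apply: eq_card => i; rewrite finset.in_set.
apply/idP/imsetP => [h|[j _ ->]]; last by rewrite /= ltn_ord.
by exists (Ordinal h) => //; apply: val_inj.
Qed.

(** Besides the fixed points and, if [d], the 2-cycle, there is one cycle increasing by one from [f]
    or [f + 2], so every cycle meets the first [f + 3] points. The condition [f + 4 <= n] keeps this
    cycle from being a fixed point and, without [d], from being a 2-cycle. *)
Lemma cyc_perm_spec (n f : nat) (d : bool) : (f + 4 <= n)%N ->
  exists s : 'S_n, [/\ #|[set p | s p == p]| = f,
    forall i, exists k (j : 'I_n), (j < f + 3)%N /\ i = iter k s j
  & if d then exists a b, [/\ a != b, s a = b & s b = a]
    else forall a, s (s a) = a -> s a = a].
Proof.
move=> fn; have [s sE] := cyc_perm d fn; exists s; split.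
- rewrite -[RHS](card_ord_lt (n := n)); last by lia.
  apply: eq_card => i; rewrite !finset.in_set -val_eqE /= sE /cyc_fun.
  have := ltn_ord i; case: (d) => /=; do ?case: ifP; lia.
(* Every [i >= f + 3] is the image of its predecessor. *)
- move=> i; have [m] := ubnP (val i); elim: m i => // m IH i im.
  have [h|h] := ltnP i (f + 3); first by exists 0%N, i.
  have i1 : (i.-1 < n)%N by have := ltn_ord i; lia.
  have [|k [j [jf e]]] := IH (Ordinal i1); first by move: im h => /=; lia.
  exists k.+1, j; split=> //=; rewrite -e; apply: val_inj.
  rewrite /= sE /cyc_fun /=; have := ltn_ord i; move: h.
  by case: (d) => /=; do ?case: ifP; lia.
- case: d sE => sE.
    have h0 : (f < n)%N by lia.
    have h1 : (f.+1 < n)%N by lia.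
    exists (Ordinal h0), (Ordinal h1); split.
    + by rewrite -val_eqE /= neq_ltn ltnSn.
    + by apply: val_inj; rewrite /= sE /cyc_fun /= ltnn eqxx.
    + apply: val_inj; rewrite /= sE /cyc_fun /=; do ?case: ifP; lia.
  move=> a h; apply: val_inj; have := congr1 val h; rewrite /= !sE.
  have := ltn_ord a; rewrite /cyc_fun /=; do ?case: ifP; lia.
Qed.

(* [r] is determined by [s ^ r] and by its values on a set meeting all the
   cycles of [s]. *)
Lemma conj_fibre (n m : nat) (s t : 'S_n) : (m <= n)%N ->
  (forall i, exists k (j : 'I_n), (j < m)%N /\ i = iter k s j) ->
  (#|[set r | (s ^ r)%g == t]| <= n ^ m)%N.
Proof.
move=> mn gen.
pose res (r : 'S_n) : {ffun 'I_m -> 'I_n} := [ffun j => r (widen_ord mn j)].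
rewrite -[X in (_ <= X ^ _)%N](card_ord n) -[X in (_ <= _ ^ X)%N](card_ord m).
rewrite -card_ffun; have inj : {in [set r | (s ^ r)%g == t] &, injective res}.
  move=> r r'; rewrite !finset.in_set => /eqP hr /eqP hr' /ffunP e.
  have step (q : 'S_n) : (s ^ q)%g = t -> forall k j, q (iter k s j) = iter k t (q j).
    move=> hq k j; elim: k => //= k IH.
    by rewrite -IH -hq permJ.
  apply/permP => i; have [k [j [jm ->]]] := gen i.
  rewrite (step _ hr) (step _ hr'); congr (iter k t _).
  have := e (Ordinal jm); rewrite !ffunE.
  by rewrite (_ : widen_ord mn (Ordinal jm) = j) //; apply: val_inj.
by rewrite -(card_in_imset inj) max_card.
Qed.

Lemma conj_count (n m : nat) (s : 'S_n) (S : {set 'S_n}) : (m <= n)%N ->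
  (forall i, exists k (j : 'I_n), (j < m)%N /\ i = iter k s j) ->
  (#|[set r | (s ^ r)%g \in S]| <= #|S| * n ^ m)%N.
Proof.
move=> mn gen; rewrite -sum1_card (partition_big (fun r => (s ^ r)%g) (mem S)) /=.
  rewrite -sum_nat_const leq_sum // => t tS.
  apply: leq_trans (conj_fibre t mn gen); rewrite -sum1_card.
  rewrite [X in (_ <= X)%N](eq_bigl (fun r => (s ^ r)%g == t)); last first.
    by move=> r; rewrite finset.in_set.
  rewrite [X in (X <= _)%N](eq_bigl (fun r => (s ^ r)%g == t)) // => r.
  by rewrite finset.in_set; case: eqP => [->|_]; rewrite ?tS ?andbF.
by move=> r; rewrite finset.in_set.
Qed.

(** The class average forces many [r] with [s ^ r] good, since [bil] is at most 1 on those and below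
    [th] on the rest. Each good permutation arises from at most [n ^ (f + 3)] of them, and
    [(n.-2)! / n!] is at least [n ^- 2]. *)
Lemma ring_count (R : realFieldType) (n f : nat) (A B : 'M[R]_n) (th : R) :
  (3 <= f)%N -> (f + 4 <= n)%N -> zero_sum A -> zero_sum B -> 0 <= th ->
  (forall s, bil A B s <= 1) -> bil A B 1%g = 1 ->
  f%:R * (f%:R - 3) / n%:R ^+ 2 - th <=
  #|[set s | th <= bil A B s]|%:R / n`!%:R * n%:R ^+ (f + 3).
Proof.
move=> f3 fn Az Bz th0 F1 one; have n4 : (4 <= n)%N by lia.
have n4R : 4 <= n%:R :> R by rewrite ler_nat.
have f3R : 3 <= f%:R :> R by rewrite ler_nat.
have c20 : 0 < (n.-2)`!%:R :> R by rewrite ltr0n fact_gt0.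
have f0 : 0 < n`!%:R :> R by rewrite ltr0n fact_gt0.
have nsq : 0 < n%:R ^+ 2 :> R by rewrite exprn_gt0 //; lra.
set S := [set s | th <= bil A B s].
have [s [gen ge]] : exists s : 'S_n,
    (forall i, exists k (j : 'I_n), (j < f + 3)%N /\ i = iter k s j) /\
    (n.-2)`!%:R * bil A B 1%g * (f%:R * (f%:R - 3)) <=
      \sum_(r : 'S_n) bil A B (s ^ r)%g.
  have [G0|/ltW G0] := leP 0 (\sum_i \sum_j A i j * B j i).
    have [s [cf gen cyc]] := cyc_perm_spec true fn; exists s; split=> //.
    by apply: class_sum_ge => //; rewrite ?one //; left.
  have [s [cf gen cyc]] := cyc_perm_spec false fn; exists s; split=> //.
  by apply: class_sum_ge => //; rewrite ?one //; right.
have fm : (f + 3 <= n)%N by lia.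
have cnt := conj_count S fm gen.
have up : \sum_(r : 'S_n) bil A B (s ^ r)%g <=
    #|S|%:R * n%:R ^+ (f + 3) + n`!%:R * th.
  apply: (@le_trans _ _ (\sum_(r : 'S_n) (((s ^ r)%g \in S)%:R + th))).
    apply: ler_sum => r _; rewrite finset.in_set.
    by have := F1 (s ^ r)%g; case: (leP th) => /= h; lra.
  rewrite big_split /= sumr_const card_Sn -[X in _ + X <= _]mulr_natl lerD2r.
  apply: (@le_trans _ _ (#|[set r | (s ^ r)%g \in S]|%:R)).
    rewrite -sum1_card natr_sum [leRHS]big_mkcond ler_sum // => r _.
    by rewrite [X in _ <= (if X then _ else _)]finset.in_set; case: (_ \in S).
  by rewrite -natrX -natrM ler_nat.
have fc : n`!%:R <= n%:R ^+ 2 * (n.-2)`!%:R :> R.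
  rewrite factR_pred2 1?ltnW 1?ltnW // ler_pM2r // expr2 ler_wpM2l //; lra.
rewrite lerBlDr -(ler_pM2l f0) [leRHS]mulrDr.
have -> : n`!%:R * (#|S|%:R / n`!%:R * n%:R ^+ (f + 3)) =
    #|S|%:R * n%:R ^+ (f + 3) :> R by field; rewrite gt_eqF.
apply: le_trans up; apply: le_trans ge; rewrite one mulr1.
have : 0 <= f%:R * (f%:R - 3) :> R by rewrite mulr_ge0 // subr_ge0.
move: (f%:R * (f%:R - 3)) => x x0.
rewrite mulrA ler_pdivrMr // mulrAC ler_wpM2r //.
by rewrite mulrC.
Qed.

(** * Normalization *)

(** Zero line sums of [A] annihilate functions of a single index, and its zero diagonal hides the
    diagonal of [B]. *)
Lemma bil_ext (R : realFieldType) (n : nat) (A B B' : 'M[R]_n)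
    (u v : 'I_n -> R) (s : 'S_n) : zero_sum A ->
  (forall i j, i != j -> B' i j = B i j - u i - v j) -> bil A B s = bil A B' s.
Proof.
move=> [Ar Ac Ad] BB'.
have -> : bil A B' s = bil A B s - \sum_i \sum_j A i j * u (s i)
    - \sum_j \sum_i A i j * v (s j).
  rewrite [X in _ - X]exchange_big /bil -!sumrB; apply: eq_bigr => i _.
  rewrite -!sumrB; apply: eq_bigr => j _.
  have [<-|ij] := eqVneq i j; first by rewrite Ad; ring.
  by rewrite BB' ?(inj_eq perm_inj) //; ring.
rewrite big1 => [|i _]; last by rewrite -mulr_suml Ar mul0r.
by rewrite big1 ?subr0 // => j _; rewrite -mulr_suml Ac mul0r.
Qed.

(** The functions [u] and [v] must cancel the off-diagonal row and column sums. Once the sums of [u]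
    and of [v] are prescribed as [T / (2 * (n - 1))], the conditions decouple into a 2 by 2 system
    for each index. *)
Lemma double_center (R : realFieldType) (n : nat) (B : 'M[R]_n) :
  (4 <= n)%N -> exists2 B' : 'M[R]_n, zero_sum B' &
  exists u v, forall i j, i != j -> B' i j = B i j - u i - v j.
Proof.
move=> n4; have n4R : 4 <= n%:R :> R by rewrite ler_nat.
pose r k := \sum_(l | l != k) B k l; pose c l := \sum_(k | k != l) B k l.
pose T := \sum_k r k.
have Tc : T = \sum_l c l.
  rewrite /T /r /c; under eq_bigr do rewrite big_mkcond.
  rewrite exchange_big; apply: eq_bigr => l _; rewrite [RHS]big_mkcond.
  by apply: eq_bigr => k _; rewrite eq_sym.
pose d : R := T / (2 * (n%:R - 1) * (n%:R - 2)).
(* [mix] solves this system, whose determinant is [n * (n - 2)]; the shift [d] produces the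
   prescribed sums. *)
pose mix x y := ((n%:R - 1) * x + y) / (n%:R * (n%:R - 2)) - d.
have n0 : n%:R != 0 :> R by apply/eqP; lra.
have n1 : n%:R - 1 != 0 :> R by apply/eqP; lra.
have n2 : n%:R - 2 != 0 :> R by apply/eqP; lra.
have summix (x y : 'I_n -> R) : \sum_k x k = T -> \sum_k y k = T ->
    \sum_k mix (x k) (y k) = T / (2 * (n%:R - 1)).
  move=> hx hy; rewrite sumrB -mulr_suml big_split /= -mulr_sumr hx hy.
  rewrite sumr_const card_ord -mulr_natl /d; field.
  by rewrite n0 n1 n2.
have step x y : (n%:R - 1) * mix x y - mix y x = x - T / (2 * (n%:R - 1)).
  by rewrite /mix /d; field; rewrite n0 n1 n2.
have [u [v [sv sv' su su']]] : exists u v : 'I_n -> R,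
    [/\ \sum_l v l = T / (2 * (n%:R - 1)), \sum_l u l = T / (2 * (n%:R - 1)),
        forall k, (n%:R - 1) * u k - v k = r k - T / (2 * (n%:R - 1))
      & forall l, (n%:R - 1) * v l - u l = c l - T / (2 * (n%:R - 1))].
  exists (fun k => mix (r k) (c k)), (fun l => mix (c l) (r l)).
  by split=> [||k|l]; [exact: summix | exact: summix | exact: step | exact: step].
exists (\matrix_(k, l) if k == l then 0 else B k l - u k - v l); last first.
  by exists u, v => i j ij; rewrite mxE (negbTE ij).
have cardne (k : 'I_n) : \sum_(l | l != k) (1 : R) = n%:R - 1.
  have : \sum_(l : 'I_n) (1 : R) = n%:R by rewrite sumr_const card_ord.
  by rewrite (bigD1 k) //= => <-; ring.
split=> [k|l|k]; last by rewrite mxE eqxx.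
- rewrite (bigD1 k) //= mxE eqxx add0r.
  rewrite (eq_bigr (fun l => B k l - u k * 1 - v l)) => [|l lk]; last first.
    by rewrite mxE eq_sym (negbTE lk) mulr1.
  rewrite !sumrB -mulr_sumr cardne -/(r k).
  by move: sv; rewrite (bigD1 k) //=; have := su k; lra.
- rewrite (bigD1 l) //= mxE eqxx add0r.
  rewrite (eq_bigr (fun k => B k l - u k - v l * 1)) => [|k kl]; last first.
    by rewrite mxE (negbTE kl) mulr1.
  rewrite !sumrB -mulr_sumr cardne -/(c l).
  by move: sv'; rewrite (bigD1 l) //=; have := su' l; lra.
Qed.

(** Shifting the off-diagonal and the diagonal entries of [A] by constants changes [qap] by an
    amount independent of [s]; since [bil] has mean zero, that amount is the mean of [qap]. *)
Lemma qap0_bil (R : realType) (n : nat) (A B : 'M[R]_n) : (4 <= n)%N ->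
  const_line_sums A -> const_diagonal A ->
  exists A' B' : 'M[R]_n, [/\ zero_sum A', zero_sum B' &
    forall s, qap0 A B s = bil A' B' s].
Proof.
move=> n4 [a [Ac Ar]] [b Ad].
have n4R : 4 <= n%:R :> R by rewrite ler_nat.
have n1 : n%:R - 1 != 0 :> R by apply/eqP; lra.
(* [m] is the average off-diagonal entry of [A]. *)
have [m nm] : exists m : R, a - n%:R * m - (b - m) = 0.
  by exists ((a - b) / (n%:R - 1)); field.
pose A' : 'M[R]_n := \matrix_(i, j) (A i j - m - (i == j)%:R * (b - m)).
have delta (k : 'I_n) : \sum_(p : 'I_n) (k == p)%:R = 1 :> R.
  by rewrite (bigD1 k) //= eqxx big1 ?addr0 // => p; rewrite eq_sym => /negbTE ->.
have Az : zero_sum A'.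
  split=> [i|j|i]; last by rewrite mxE eqxx Ad mul1r subrr.
    under eq_bigr do rewrite mxE.
    rewrite !sumrB -mulr_suml delta Ar sumr_const card_ord -mulr_natl mul1r.
    exact: nm.
  under eq_bigr do rewrite mxE eq_sym.
  rewrite !sumrB -mulr_suml delta Ac sumr_const card_ord -mulr_natl mul1r.
  exact: nm.
have [B' Bz [u [v BB']]] := double_center B n4.
exists A', B'; split=> // s.
pose c := m * \sum_i \sum_j B i j + (b - m) * \sum_i B i i.
have qE t : qap A B t = bil A' B' t + c.
  rewrite -(bil_ext t Az BB') /c /qap /bil.
  rewrite [X in _ + (_ * X + _)](reindex_inj (@perm_inj _ t)).
  rewrite [X in _ + (_ + _ * X)](reindex_inj (@perm_inj _ t)) /=.
  rewrite !mulr_sumr -!big_split; apply: eq_bigr => i _ /=.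
  rewrite [X in _ + (_ * X + _)](reindex_inj (@perm_inj _ t)) /=.
  have -> : (b - m) * B (t i) (t i) =
      \sum_j (i == j)%:R * ((b - m) * B (t i) (t j)).
    rewrite (bigD1 i) //= eqxx mul1r big1 ?addr0 // => j.
    by rewrite eq_sym => /negbTE ->; rewrite mul0r.
  rewrite mulr_sumr -!big_split; apply: eq_bigr => j _ /=.
  by rewrite mxE; ring.
have f0 : n`!%:R != 0 :> R by rewrite pnatr_eq0 -lt0n fact_gt0.
rewrite /qap0 /qap_mean; under eq_bigr do rewrite qE.
rewrite qE big_split /= sum_bil // add0r sumr_const card_Sn -[c *+ _]mulr_natl.
by rewrite mulKf // addrK.
Qed.

(** Composing with [t] moves the optimum to the identity and dividing by the maximum makes its value
    1; translation by [t] preserves the number of good permutations. *)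
Lemma normalized_prob (R : realType) (n : nat) (A B : 'M[R]_n) (t : 'S_n)
    (r p : R) : (4 <= n)%N -> const_line_sums A -> const_diagonal A ->
  qap_optimal A B t -> p <= 1 ->
  (forall A B : 'M[R]_n, zero_sum A -> zero_sum B -> (forall s, bil A B s <= 1) ->
     bil A B 1%g = 1 -> p <= #|[set s | r <= bil A B s]|%:R / n`!%:R) ->
  p <= perm_prob R (fun s => r * qap0 A B t <= qap0 A B s).
Proof.
move=> n4 Al Ad opt p1 hyp.
have [A' [B' [Az Bz E]]] := qap0_bil B n4 Al Ad.
have f0 : 0 < n`!%:R :> R by rewrite ltr0n fact_gt0.
have {}opt s : bil A' B' s <= bil A' B' t by have := opt s; rewrite !E.
rewrite /perm_prob (_ : [set s | _] = [set s | r * bil A' B' t <= bil A' B' s]);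
  last by apply/setP => s; rewrite !finset.in_set !E.
set M := bil A' B' t in opt *.
have M0 : 0 <= M.
  have : \sum_(s : 'S_n) bil A' B' s <= \sum_(s : 'S_n) M by apply: ler_sum.
  by rewrite sum_bil // sumr_const card_Sn -mulr_natl pmulr_rge0.
(* If the maximum is 0, mean zero forces the function to vanish, so every permutation passes and
   [p <= 1] concludes. *)
have [Mz|Mn0] := eqVneq M 0.
  have all0 s : bil A' B' s = 0.
    have : \sum_(s : 'S_n) - bil A' B' s == 0 by rewrite sumrN sum_bil // oppr0.
    rewrite psumr_eq0 => [/allP /(_ s)|s' _]; last by rewrite oppr_ge0 -Mz.
    by rewrite mem_index_enum oppr_eq0 => /(_ isT) /eqP.
  rewrite (_ : [set s | _] = [set: 'S_n]); last first.
    by apply/setP => s; rewrite !finset.in_set Mz mulr0 all0 lexx.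
  by rewrite cardsT card_Sn divff // gt_eqF.
have Mpos : 0 < M by rewrite lt_def Mn0.
pose A1 := M^-1 *: A'; pose B1 : 'M[R]_n := \matrix_(i, j) B' (t i) (t j).
have F1 s : bil A1 B1 s = M^-1 * bil A' B' (s * t)%g.
  rewrite /bil mulr_sumr; apply: eq_bigr => i _.
  rewrite mulr_sumr; apply: eq_bigr => j _.
  by rewrite !mxE !permM mulrA.
have A1z : zero_sum A1.
  have [A'r A'c A'd] := Az; split=> [i|j|i]; last by rewrite mxE A'd mulr0.
    by under eq_bigr do rewrite mxE; rewrite -mulr_sumr A'r mulr0.
  by under eq_bigr do rewrite mxE; rewrite -mulr_sumr A'c mulr0.
have B1z : zero_sum B1.
  have [B'r B'c B'd] := Bz; split=> [i|j|i]; last by rewrite mxE B'd.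
    under eq_bigr do rewrite mxE.
    by rewrite -[RHS](B'r (t i)) [RHS](reindex_inj (@perm_inj _ t)).
  under eq_bigr do rewrite mxE.
  by rewrite -[RHS](B'c (t j)) [RHS](reindex_inj (@perm_inj _ t)).
have := hyp A1 B1 A1z B1z _ _.
have -> : #|[set s | r <= bil A1 B1 s]| = #|[set s | r * M <= bil A' B' s]|.
  rewrite -(card_imset _ (mulIg t)); apply: eq_card => s.
  rewrite finset.in_set; apply/imsetP/idP => [[q]|h].
    by rewrite finset.in_set F1 ler_pdivlMl // mulrC => h ->.
  exists (s * t^-1)%g; last by rewrite mulgKV.
  by rewrite finset.in_set F1 mulgKV ler_pdivlMl // mulrC.
apply; first by move=> s; rewrite F1 ler_pdivrMl // mulr1.
by rewrite F1 mul1g mulVf.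
Qed.

(** * Asymptotics for part (2) and conclusion *)

Lemma expRXn (R : realType) (n k : nat) : (0 < n)%N ->
  n%:R ^+ k = expR (k%:R * ln n%:R) :> R.
Proof. by move=> n0; rewrite expRM_natl lnK // posrE ltr0n. Qed.

Lemma powR_expR (R : realType) (n : nat) (x : R) : (0 < n)%N ->
  n%:R `^ x = expR (x * ln n%:R).
Proof. by move=> n0; rewrite /powR pnatr_eq0 -[n == 0%N]negbK -lt0n n0. Qed.

Lemma ln_le_expR (R : realType) (th l : R) : 0 < th -> l <= expR (th * l) / th.
Proof.
move=> th0; rewrite ler_pdivlMr // mulrC; apply: le_trans (expR_ge1Dx _).
by rewrite lerDr.
Qed.

(** For [y = n ^ (1 - eps / 2)] one has [y ^ 2 = n ^ (- eps) * n ^ 2], so about [2 * y] fixed points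
    lift the class average well above the threshold. The price [n ^ (f + 3)] is the exponential of a
    quantity of order [y * ln n], which [n ^ delta] dominates. *)
Lemma ring_eventually (R : realType) (eps delta : R) : 0 < eps -> eps < 2 ->
  1 - eps / 2 < delta -> exists N : nat,
  forall (n : nat) (A B : 'M[R]_n), (4 <= n)%N -> (N <= n)%N ->
  zero_sum A -> zero_sum B -> (forall s, bil A B s <= 1) ->
  bil A B 1%g = 1 ->
  expR (- (n%:R `^ delta)) <=
  #|[set s | n%:R `^ (- eps) <= bil A B s]|%:R / n`!%:R.
Proof.
(* The gap between the exponents is split in two: one factor [n ^ th] absorbs the logarithm, the
   other the constant [11 / th]. *)
move=> e0 e2 ed; pose th := (delta - (1 - eps / 2)) / 2.
have th0 : 0 < th by rewrite /th; lra.
pose q : R := Num.max ((11 / th) `^ th^-1) (10 `^ (2 / eps)).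
exists (Num.truncn q).+1 => n A B n4 nN Az Bz F1 one.
have qn : q < n%:R by apply: lt_le_trans (truncnS_gt _) _; rewrite ler_nat.
have n0 : (0 < n)%N by lia.
have n4R : 4 <= n%:R :> R by rewrite ler_nat.
set l : R := ln n%:R; have nE : n%:R = expR l :> R by rewrite lnK // posrE; lra.
have l0 : 0 <= l by rewrite ln_ge0 //; lra.
pose y := expR ((1 - eps / 2) * l).
have y1 : 1 <= y by rewrite -expR0 ler_expR mulr_ge0 //; lra.
have big (a x : R) : 0 <= a -> 0 < x -> a `^ x^-1 <= n%:R -> a <= expR (x * l).
  move=> a0 x0 h; have xn : x != 0 by rewrite gt_eqF.
  rewrite /l -powR_expR // -[leLHS](powRr1 a0) -[X in _ `^ X <= _](mulVf xn).
  rewrite powRrM ge0_ler_powR ?(ltW x0) ?nnegrE ?powR_ge0 //.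
have large : 10 <= expR (eps / 2 * l).
  apply: big; rewrite ?divr_gt0 // invf_div.
  by apply/ltW; apply: le_lt_trans qn; rewrite le_max lexx orbT.
have largeth : 11 / th <= expR (th * l).
  apply: (big _ _ _ th0); first by rewrite divr_ge0 // ltW.
  by apply/ltW; apply: le_lt_trans qn; rewrite le_max lexx.
have ny : 10 * y <= n%:R.
  rewrite nE (_ : l = eps / 2 * l + (1 - eps / 2) * l); last by ring.
  by rewrite expRD ler_wpM2r // expR_ge0.
(* The offset 4 gives [f - 3 >= 2 * y], so [f * (f - 3) >= (2 * y) ^ 2], while
   [f + 4 <= 10 * y <= n]. *)
pose f := (Num.truncn (2 * y) + 4)%N.
have fy : 2 * y + 3 <= f%:R.
  by have := truncnS_gt (2 * y); rewrite /f natrD -natr1; lra.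
have fy' : f%:R <= 2 * y + 4.
  have : (Num.truncn (2 * y))%:R <= 2 * y by rewrite truncn_le; lra.
  by rewrite /f natrD; lra.
have f3 : (3 <= f)%N by rewrite /f addn4.
have fn : (f + 4 <= n)%N by rewrite -(ler_nat R) natrD; lra.
have tE : n%:R `^ (- eps) = expR (- eps * l) by exact: powR_expR.
rewrite tE; set t := expR (- eps * l).
have t0 : 0 < t by exact: expR_gt0.
have := ring_count f3 fn Az Bz (ltW t0) F1 one.
set P := _ / _; set z := n%:R ^+ (f + 3).
have yt : y ^+ 2 = t * n%:R ^+ 2.
  by rewrite nE /y /t -!expRM_natl -expRD; congr expR; field.
have nsq : 0 < n%:R ^+ 2 :> R by rewrite exprn_gt0 //; lra.
have low : t <= f%:R * (f%:R - 3) / n%:R ^+ 2 - t.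
  rewrite lerBrDr ler_pdivlMr // mulrDl -yt.
  have : 2 * y * (2 * y) <= f%:R * (f%:R - 3) by rewrite ler_pM //; lra.
  by rewrite expr2; have := mulr_ge0 (le_trans ler01 y1) (le_trans ler01 y1); lra.
move/(le_trans low).
have zE : z = expR ((f + 3)%:R * l) by rewrite /z expRXn.
have z0 : 0 < z by rewrite zE expR_gt0.
rewrite -ler_pdivrMr //; apply: le_trans.
rewrite zE -expRN -expRD ler_expR powR_expR // -/l.
have key : 11 * y * l <= expR (delta * l).
  have -> : delta * l = (1 - eps / 2) * l + (th * l + th * l) by rewrite /th; field.
  rewrite !expRD -/y (_ : 11 * y * l = y * (11 * l)); last by ring.
  rewrite ler_wpM2l ?(le_trans ler01 y1) //.
  apply: (@le_trans _ _ (11 / th * expR (th * l))).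
    by rewrite mulrAC -mulrA ler_wpM2l // ln_le_expR.
  by rewrite ler_wpM2r // expR_ge0.
(* Here [f + 3 <= 2 * y + 7], [eps < 2] and [1 <= y]. *)
have h1 : (eps + (f + 3)%:R) * l <= 11 * y * l.
  by rewrite ler_wpM2r // natrD; lra.
by lra.
Qed.

Theorem corollary3p2 (R : realType) :
  ((forall alpha : R, 1 < alpha ->
      exists2 delta : R, 0 < delta &
        eventually_prob_ge (fun n => alpha / n%:R ^+ 2)
                           (fun n => delta * n%:R ^- 2))
   /\
   (exists2 c : R, 0 < c &
      forall alpha : R, 1 < alpha ->
        eventually_prob_ge (fun n => alpha / n%:R ^+ 2)
          (fun n => expR (- c * Num.sqrt alpha * ln alpha) * n%:R ^- 2)))
  /\
  ((forall epsilon : R, 0 < epsilon ->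
      exists2 delta : R, delta < 1 &
        eventually_prob_ge (fun n => n%:R `^ (- epsilon))
                           (fun n => expR (- (n%:R `^ delta))))
   /\
   (forall epsilon delta : R, 0 < epsilon -> 0 < delta ->
      1 - epsilon / 2 < delta ->
        eventually_prob_ge (fun n => n%:R `^ (- epsilon))
                           (fun n => expR (- (n%:R `^ delta))))).
Proof.
have part1 (alpha delta : R) : 1 < alpha -> 0 < delta -> delta < 1 ->
    eventually_prob_ge (fun n => alpha / n%:R ^+ 2)
                       (fun n => delta * n%:R ^- 2).
  move=> a1 d0 d1.
  have [N hN] := good_count (ltW (lt_trans ltr01 a1)) (ltW d0) d1.
  exists N => n A B t n4 nN Al Ad opt; apply: normalized_prob => //.
    rewrite -[leRHS]mulr1 ler_pM ?(ltW d0) ?(ltW d1) ?invr_ge0 ?exprn_ge0 //.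
    by rewrite invf_le1 ?exprn_gt0 ?ltr0n ?(leq_trans _ n4) // exprn_ege1 // ler1n (leq_trans _ n4).
  by move=> A' B'; exact: hN.
have part2 (epsilon delta : R) : 0 < epsilon -> 0 < delta ->
    1 - epsilon / 2 < delta ->
    eventually_prob_ge (fun n => n%:R `^ (- epsilon))
                       (fun n => expR (- (n%:R `^ delta))).
  move=> e0 d0 ed.
  have [e [e'0 e'2 e'e e'd]] :
      exists e : R, [/\ 0 < e, e < 2, e <= epsilon & 1 - e / 2 < delta].
    have [h|h] := ltP epsilon 2; first by exists epsilon.
    (* For [epsilon >= 2] a smaller exponent gives a larger threshold, hence a stronger bound; this
       one is below 2 and still satisfies [1 - e / 2 < delta]. *)
    exists (Num.max 1 (2 - delta)); split.
    - by rewrite lt_max ltr01.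
    - by rewrite gt_max; apply/andP; split; lra.
    - by rewrite ge_max; apply/andP; split; lra.
    - have : 2 - delta <= Num.max 1 (2 - delta) by rewrite le_max lexx orbT.
      by lra.
  have [N hN] := ring_eventually e'0 e'2 e'd.
  exists N => n A B t n4 nN Al Ad opt.
  have p1 : expR (- (n%:R `^ delta)) <= 1 :> R.
    by rewrite -[leRHS]expR0 ler_expR oppr_le0 powR_ge0.
  apply: normalized_prob => //.
  move=> A' B' Az Bz F1 one; apply: le_trans (hN n A' B' n4 nN Az Bz F1 one) _.
  rewrite ler_wpM2r ?invr_ge0 // ler_nat subset_leq_card //.
  apply/fintype.subsetP => s; rewrite !finset.in_set; apply: le_trans.
  by rewrite ler_powR ?lerN2 // ler1n (leq_trans _ n4).
have lt1 (alpha : R) : 1 < alpha -> expR (- 1 * Num.sqrt alpha * ln alpha) < 1.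
  move=> a1; rewrite -[ltRHS]expR0 ltr_expR mulN1r mulNr oppr_lt0 mulr_gt0 ?ln_gt0 //.
  by rewrite sqrtr_gt0 (lt_trans ltr01).
split; split; last exact: part2.
- move=> alpha a1; exists (1 / 2); first by rewrite divr_gt0.
  by apply: part1 => //; lra.
(* With [c = 1] the factor is below 1 for every [alpha > 1], so [part1] covers it. *)
- by exists 1 => // alpha a1; apply: part1; rewrite ?expR_gt0 ?lt1.
(* [1 - epsilon / 4] lies strictly between [1 - epsilon / 2] and 1; the maximum with [1 / 2] keeps
   [delta] positive. *)
- move=> epsilon e0; exists (Num.max (1 / 2) (1 - epsilon / 4)).
    by rewrite gt_max; apply/andP; split; lra.
  have h1 : 1 / 2 <= Num.max (1 / 2) (1 - epsilon / 4) by rewrite le_max lexx.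
  have h2 : 1 - epsilon / 4 <= Num.max (1 / 2) (1 - epsilon / 4).
    by rewrite le_max lexx orbT.
  by apply: part2 => //; lra.
Qed.
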